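(* Let $\Gamma\leq\mathrm{Aff}(n)$ be a crystallographic group and let $\mathcal{O}=\Gamma\backslash\mathbb{R}^n$. Then the moduli space of flat metrics $\mathcal{M}_{\mathrm{flat}}(\mathcal{O})$ is a very good orbifold.
   Context: $\mathrm{Aff}(n)=\mathbb{R}^n\rtimes\mathrm{GL}_n(\mathbb{R})$ is the group of affine transformations $(A,v)\colon x\mapsto Ax+v$, and $\tau\colon\mathrm{Aff}(n)\to\mathrm{GL}_n(\mathbb{R})$, $(A,v)\mapsto A$. A crystallographic group is a discrete subgroup $\Gamma$ of $\mathrm{Iso}(n)=\mathrm{O}_n(\mathbb{R})\ltimes\mathbb{R}^n\leq\mathrm{Aff}(n)$ with $\mathbb{R}^n/\Gamma$ compact; its holonomy is the finite group $H_\Gamma=\tau(\Gamma)$. $\mathrm{N}_G(H)$ denotes the normalizer of $H$ in $G$. $\mathcal{T}_{\mathrm{flat}}(\mathcal{O})=\mathrm{O}_n(\mathbb{R})\backslash\mathcal{C}_\Gamma$, where $\mathcal{C}_\Gamma=\{X\in\mathrm{GL}_n(\mathbb{R})\mid XH_\Gamma X^{-1}\subset\mathrm{O}_n(\mathbb{R})\}$, and $\mathcal{M}_{\mathrm{flat}}(\mathcal{O})=\mathcal{T}_{\mathrm{flat}}(\mathcal{O})/\mathcal{N}_\Gamma$, where $\mathcal{N}_\Gamma=\tau(\mathrm{N}_{\mathrm{Aff}(n)}(\Gamma))$ acts by right matrix multiplication. A good orbifold is a quotient $M/G$ of a manifold $M$ by a smooth proper action of a discrete group $G$; it is very good if it is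 a quotient of a manifold by a finite group, equivalently if it has a finite orbifold covering by a manifold. Here the orbifold structure on $\mathcal{M}_{\mathrm{flat}}(\mathcal{O})$ is that of the quotient of the manifold $\mathcal{T}_{\mathrm{flat}}(\mathcal{O})$ by $\mathcal{N}_\Gamma$. *)

(* Defs.v *)
From HB Require Import structures.
From mathcomp Require Import all_boot all_order all_algebra fingroup.
From mathcomp Require Import all_classical all_reals all_analysis.

Set Implicit Arguments.
Unset Strict Implicit.
Unset Printing Implicit Defensive.

Import Order.TTheory GRing.Theory Num.Theory.
Import numFieldNormedType.Exports.

Local Open Scope classical_set_scope.
Local Open Scope quotient_scope.
Local Open Scope ring_scope.

Record subgroup (G : groupType) := Subgroup {
  subgroup_set :> set G;
  subgroup_closed : group_closed (fun x : G => x \in subgroup_set) }.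

Section SubgroupTheory.
Variables (G : groupType) (H : subgroup G).

Lemma subgroup1 : subgroup_set H 1%g.
Proof. by have [/set_mem] := subgroup_closed H. Qed.

Lemma subgroupF x y :
  subgroup_set H x -> subgroup_set H y -> subgroup_set H (x / y)%g.
Proof.
by case: (subgroup_closed H) => _ c Hx Hy; apply/set_mem/c; rewrite ?inE.
Qed.

Lemma subgroupV x : subgroup_set H x -> subgroup_set H x^-1%g.
Proof.
by move=> Hx; rewrite -[(x^-1)%g]mul1g; exact/subgroupF/Hx/subgroup1.
Qed.

Lemma subgroupM x y :
  subgroup_set H x -> subgroup_set H y -> subgroup_set H (x * y)%g.
Proof.
by move=> Hx Hy; rewrite -[y]invgK; apply: subgroupF => //; exact: subgroupV.
Qed.

End SubgroupTheory.

Definition subgroup_type (G : groupType) (H : subgroup G) : Type := set_type H.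

Section SubgroupGroup.
Variables (G : groupType) (H : subgroup G).
HB.instance Definition _ := SubChoice.copy (subgroup_type H) (set_type H).
HB.instance Definition _ :=
  SubChoice_isSubGroup.Build G _ (subgroup_type H) (subgroup_closed H).
End SubgroupGroup.

Section Normalizer.
Variables (G : groupType) (H : subgroup G).

Definition normalizer_set : set G := [set g | [set (h ^ g)%g | h in H] = H].

Lemma normalizerP g :
  normalizer_set g <->
  forall h, subgroup_set H (h ^ g)%g <-> subgroup_set H h.
Proof.
split=> [Ng h|Ng].
  split=> [|Hh]; last by rewrite -[X in X _]Ng; exists h.
  by rewrite -[X in X (h ^ g)%g]Ng => -[k Hk /conjg_inj <-].
apply/seteqP; split=> [_ [h Hh <-]|h Hh]; first exact/Ng.
by exists (h ^ g^-1)%g; rewrite ?conjgKV//; apply/Ng; rewrite conjgKV.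
Qed.

Lemma normalizer_closed : group_closed (fun x : G => x \in normalizer_set).
Proof.
split=> [|x y]; rewrite !inE.
  by apply/normalizerP => h; rewrite conjg1.
move=> /normalizerP Nx /normalizerP Ny; apply/normalizerP => h.
by rewrite conjgM -Ny conjgKV; exact: Nx.
Qed.

Definition normalizer := Subgroup normalizer_closed.

End Normalizer.

Section ImageSubgroup.
Variables (G K : groupType) (f : {multiplicative G -> K}) (H : subgroup G).

Lemma image_subgroup_closed :
  group_closed (fun x : K => x \in [set f g | g in H]).
Proof.
have f1 : f 1%g = 1%g by apply: (mulgI (f 1%g)); rewrite -gmulfM !mulg1.
have fF x y : f (x / y)%g = (f x / f y)%g.
  by apply: (mulIg (f y)); rewrite -gmulfM !mulgVK.
split=> [|_ _ /set_mem[x Hx <-] /set_mem[y Hy <-]]; rewrite inE.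
  by exists 1%g => //; exact: subgroup1.
by exists (x / y)%g; [exact: subgroupF|exact: fF].
Qed.

Definition image_subgroup := Subgroup image_subgroup_closed.

End ImageSubgroup.

Definition GL (R : realType) (n : nat) : Type :=
  set_type [set A : 'M[R]_n | A \in unitmx].

Section GL.
Variables (R : realType) (n : nat).
Notation GL := (GL R n).

HB.instance Definition _ :=
  SubChoice.copy GL (set_type [set A : 'M[R]_n | A \in unitmx]).
HB.instance Definition _ :=
  Topological.copy GL (set_type [set A : 'M[R]_n | A \in unitmx]).

Lemma GL_unit (A : GL) : \val A \in unitmx.
Proof. exact: set_mem (valP A). Qed.

Definition toGL (A : 'M[R]_n) (uA : A \in unitmx) : GL :=
  exist _ A (mem_set uA).

Definition GL_one : GL := toGL (unitmx1 R n).

Lemma GL_mul_subproof (A B : GL) : \val A *m \val B \in unitmx.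
Proof. by rewrite unitmx_mul !GL_unit. Qed.

Lemma GL_inv_subproof (A : GL) : invmx (\val A) \in unitmx.
Proof. by rewrite unitmx_inv GL_unit. Qed.

Definition GL_mul A B := toGL (GL_mul_subproof A B).
Definition GL_inv A := toGL (GL_inv_subproof A).

Lemma GL_mulA : associative GL_mul.
Proof. by move=> A B C; apply/val_inj; rewrite /= mulmxA. Qed.
Lemma GL_mul1g : left_id GL_one GL_mul.
Proof. by move=> A; apply/val_inj; rewrite /= mul1mx. Qed.
Lemma GL_mulg1 : right_id GL_one GL_mul.
Proof. by move=> A; apply/val_inj; rewrite /= mulmx1. Qed.
Lemma GL_mulVg : left_inverse GL_one GL_inv GL_mul.
Proof. by move=> A; apply/val_inj; rewrite /= mulVmx ?GL_unit. Qed.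
Lemma GL_mulgV : right_inverse GL_one GL_inv GL_mul.
Proof. by move=> A; apply/val_inj; rewrite /= mulmxV ?GL_unit. Qed.

HB.instance Definition _ :=
  isGroup.Build GL GL_mulA GL_mul1g GL_mulg1 GL_mulVg GL_mulgV.

Lemma val_GL1 : \val (1%g : GL) = 1%:M. Proof. by []. Qed.
Lemma val_GLM (A B : GL) : \val (A * B)%g = \val A *m \val B. Proof. by []. Qed.
Lemma val_GLV (A : GL) : \val (A^-1)%g = invmx (\val A). Proof. by []. Qed.

End GL.

(** The pair [(A, v)] is the affine transformation [x |-> A x + v]. *)
Definition Aff (R : realType) (n : nat) : Type := (GL R n * 'cV[R]_n)%type.

Section Aff.
Variables (R : realType) (n : nat).
Notation Aff := (Aff R n).

HB.instance Definition _ := Choice.on Aff.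
HB.instance Definition _ := Topological.copy Aff (GL R n * 'cV[R]_n)%type.

Definition aff_fun (g : Aff) (x : 'cV[R]_n) : 'cV[R]_n := \val g.1 *m x + g.2.

Definition Aff_one : Aff := (1%g, 0).
Definition Aff_mul (g h : Aff) : Aff := ((g.1 * h.1)%g, aff_fun g h.2).
Definition Aff_inv (g : Aff) : Aff := ((g.1)^-1%g, - (invmx (\val g.1) *m g.2)).

Lemma Aff_mulA : associative Aff_mul.
Proof.
move=> f g h; congr pair; first by rewrite /= mulgA.
by rewrite /aff_fun /= /aff_fun mulmxDr mulmxA addrA.
Qed.
Lemma Aff_mul1g : left_id Aff_one Aff_mul.
Proof. by case=> A v; congr pair; rewrite ?mul1g// /aff_fun/= mul1mx addr0. Qed.
Lemma Aff_mulg1 : right_id Aff_one Aff_mul.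
Proof. by case=> A v; congr pair; rewrite ?mulg1// /aff_fun/= mulmx0 add0r. Qed.
Lemma Aff_mulVg : left_inverse Aff_one Aff_inv Aff_mul.
Proof. by case=> A v; congr pair; rewrite ?mulVg// /aff_fun/= subrr. Qed.
Lemma Aff_mulgV : right_inverse Aff_one Aff_inv Aff_mul.
Proof.
case=> A v; congr pair; rewrite ?mulgV// /aff_fun/=.
by rewrite mulmxN mulmxA mulmxV ?GL_unit// mul1mx addNr.
Qed.

HB.instance Definition _ :=
  isGroup.Build Aff Aff_mulA Aff_mul1g Aff_mulg1 Aff_mulVg Aff_mulgV.

Lemma aff_fun1 x : aff_fun 1%g x = x.
Proof. by rewrite /aff_fun mul1mx addr0. Qed.

Lemma aff_funM (g h : Aff) x : aff_fun (g * h)%g x = aff_fun g (aff_fun h x).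
Proof. by rewrite /aff_fun mulmxDr !mulmxA addrA. Qed.

Definition tau (g : Aff) : GL R n := g.1.

Lemma tauM : {morph tau : g h / (g * h)%g}. Proof. by []. Qed.
HB.instance Definition _ := isMultiplicative.Build Aff (GL R n) tau tauM.

Definition orthogonal : set 'M[R]_n := [set Q | Q^T *m Q = 1%:M].

Definition Iso : set Aff := [set g | orthogonal (\val (tau g))].

End Aff.

Section AffineOrbits.
Variables (R : realType) (n : nat) (Gamma : subgroup (Aff R n)).

Definition affine_orbit_rel : rel 'cV[R]_n :=
  fun x y => `[< exists2 g, subgroup_set Gamma g & y = aff_fun g x >].

Lemma affine_orbit_rel_equiv : equiv_class_of affine_orbit_rel.
Proof.
split=> [x|x y|y x z].
- by apply/asboolP; exists 1%g; rewrite ?aff_fun1//; exact: subgroup1.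
- apply/asbool_equiv_eq; split=> -[g Gg ->]; exists g^-1%g.
  + exact: subgroupV.
  + by rewrite -aff_funM mulVg aff_fun1.
  + exact: subgroupV.
  + by rewrite -aff_funM mulVg aff_fun1.
- move=> /asboolP[g Gg ->] /asboolP[h Gh ->]; apply/asboolP.
  by exists (h * g)%g; [exact: subgroupM|rewrite aff_funM].
Qed.
Canonical affine_orbit_equiv := EquivRelPack affine_orbit_rel_equiv.

Definition affine_quotient : topologicalType :=
  quotient_topology {eq_quot affine_orbit_equiv}.

End AffineOrbits.

Section RightActions.

Record raction (G : groupType) (X : Type) := RAction {
  ract :> X -> G -> X;
  ract1 : forall x, ract x 1%g = x;
  ractM : forall x g h, ract x (g * h)%g = ract (ract x g) h }.

Variables (G : groupType) (X : topologicalType) (act : raction G X).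

Definition orbit_rel : rel X := fun x y => `[< exists g, y = act x g >].

Lemma orbit_rel_equiv : equiv_class_of orbit_rel.
Proof.
split=> [x|x y|y x z].
- by apply/asboolP; exists 1%g; rewrite ract1.
- by apply/asbool_equiv_eq; split=> -[g ->]; exists g^-1%g;
    rewrite -ractM mulgV ract1.
- move=> /asboolP[g ->] /asboolP[h ->]; apply/asboolP.
  by exists (g * h)%g; rewrite ractM.
Qed.
Canonical orbit_equiv := EquivRelPack orbit_rel_equiv.

Definition orbit_space : topologicalType :=
  quotient_topology {eq_quot orbit_equiv}.

Definition orbit_pi : X -> orbit_space := \pi_{eq_quot orbit_equiv}%qT.

Definition stabilizer (x : X) : set G := [set g | act x g = x].

End RightActions.

(** Class [C^k] on the open set [U] of a finite-dimensional space [V], through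
    the continuity of all iterated directional derivatives; this is the usual
    notion only when [V] is finite-dimensional. *)
Fixpoint Ck (R : realType) (V : normedModType R) (k : nat) (U : set V)
    (f : V -> R) : Prop :=
  (forall x, U x -> {for x, continuous f}) /\
  if k isn't k'.+1 then True else
    (forall v x, U x -> derivable f x v) /\ (forall v, Ck k' U ('D_v f)).

Lemma CkS (R : realType) (V : normedModType R) k (U W : set V) (f g : V -> R) :
  open W -> W `<=` U -> (forall x, W x -> f x = g x) -> Ck k U f -> Ck k W g.
Proof.
move=> oW WU; elim: k f g => [|k IH] f g fg /= [cf Hf].
all: have nfg x (Wx : W x) : \near x, f x = g x by
  apply: filterS (open_nbhs_nbhs (conj oW Wx)) => y /fg.
all: have cg x : W x -> {for x, continuous g} by
  move=> Wx; rewrite /prop_for/= /continuous_at -fg//;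
  apply: (cvg_trans _ (cf x (WU _ Wx))); apply: near_eq_cvg; exact: nfg.
- by split.
split=> //; case: Hf => df Hf; split=> [v x Wx|v].
  exact: (near_eq_derivable (nfg _ Wx) (df v x (WU _ Wx))).
by apply: IH (Hf v) => x Wx; exact: (near_eq_derive v (nfg _ Wx)).
Qed.

(** A topological space with a class of smooth real functions: [smooth_at x f]
    means that [f] is smooth on some neighbourhood of [x].  This is the sheaf
    (functional structure) presentation of smooth structures, for which
    subspaces and quotients have canonical structures. *)
Record smoothSpace (R : realType) := SmoothSpace {
  smooth_sort :> topologicalType;
  smooth_at : smooth_sort -> (smooth_sort -> R) -> Prop;
  smooth_at_local : forall x f g,
    (\near x, f x = g x) -> smooth_at x f -> smooth_at x g }.

Section SmoothSpaces.
Variable R : realType.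

Section Euclidean.
Variable V : normedModType R.

Definition euclid_smooth_at (x : V) (f : V -> R) : Prop :=
  exists2 U : set V, open_nbhs x U & forall k, Ck k U f.

Lemma euclid_smooth_at_local x f g :
  (\near x, f x = g x) -> euclid_smooth_at x f -> euclid_smooth_at x g.
Proof.
rewrite /prop_near1 nbhsE => -[W [oW Wx] Wfg] [U [oU Ux] Uf].
exists (U `&` W) => [|k]; first by split; [exact: openI|].
by apply: CkS (Uf k) => [|y []//|y [_ /Wfg]//]; exact: openI.
Qed.

Definition euclid : smoothSpace R := SmoothSpace euclid_smooth_at_local.

End Euclidean.

Section Subspace.
Variables (M : smoothSpace R) (A : set M).

Definition sub_smooth_at (x : set_type A) (f : set_type A -> R) : Prop :=
  exists2 g : M -> R, smooth_at (\val x) g & \near x, f x = g (\val x).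

Lemma sub_smooth_at_local x f g :
  (\near x, f x = g x) -> sub_smooth_at x f -> sub_smooth_at x g.
Proof.
move=> fg [h sh fh]; exists h => //.
by apply: filterS2 fg fh => y <-.
Qed.

Definition sub_smooth : smoothSpace R := SmoothSpace sub_smooth_at_local.

End Subspace.

Section Quotient.
Variables (M : smoothSpace R) (e : equiv_rel M).

Let Q : topologicalType := quotient_topology {eq_quot e}.

Definition quot_pi : M -> Q := \pi_{eq_quot e}.

Definition quot_smooth_at (t : Q) (f : Q -> R) : Prop :=
  forall x : M, quot_pi x = t -> smooth_at x (f \o quot_pi).

Lemma quot_smooth_at_local t f g :
  (\near t, f t = g t) -> quot_smooth_at t f -> quot_smooth_at t g.
Proof.
move=> fg sf x xt; apply: smooth_at_local (sf x xt).
rewrite -xt in fg.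
exact: (@pi_continuous M {eq_quot e} x _ fg).
Qed.

Definition quot_smooth : smoothSpace R := SmoothSpace quot_smooth_at_local.

End Quotient.

Definition smooth_map_at (M N : smoothSpace R) (f : M -> N) (x : M) : Prop :=
  {for x, continuous f} /\
  forall h : N -> R, smooth_at (f x) h -> smooth_at x (h \o f).

(** [f] restricts to a diffeomorphism from the open set [U] onto the open set
    [V]. *)
Definition diffeo_on (M N : smoothSpace R) (U : set M) (V : set N)
    (f : M -> N) : Prop :=
  [/\ open U, open V &
   exists g : N -> M,
   [/\ {homo f : x / U x >-> V x},
       {homo g : y / V y >-> U y},
       forall x, U x -> g (f x) = x /\ smooth_map_at f x &
       forall y, V y -> f (g y) = y /\ smooth_map_at g y]].

Definition smooth_manifold (M : smoothSpace R) : Prop :=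
  [/\ hausdorff_space M, @second_countable M &
   exists d, forall x : M, exists U V (phi : M -> euclid 'rV[R]_d),
     U x /\ diffeo_on U V phi].

Definition smooth_action (G : groupType) (M : smoothSpace R)
    (act : raction G M) : Prop :=
  forall g x, smooth_map_at (act^~ g) x.

(** [G] carries the discrete topology: properness then amounts to the finiteness
    of the set of [g] that move a given compact set to one that meets it. *)
Definition proper_action (G : groupType) (M : topologicalType)
    (act : raction G M) : Prop :=
  forall K : set M, compact K ->
    finite_set [set g | ([set act x g | x in K] `&` K) !=set0].

(** The orbifold [M / G] is recorded by the action of [G] on [M]: its orbifold
    charts are open sets of [M] with the action of isotropy groups.  The action
    need not be effective. *)
Record orbifold := Orbifold {
  orb_cover : smoothSpace R;
  orb_group : groupType;
  orb_act : raction orb_group orb_cover }.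

Definition underlying_space (O : orbifold) : topologicalType :=
  orbit_space (orb_act O).

Definition good_orbifold (O : orbifold) : Prop :=
  [/\ smooth_manifold (orb_cover O), smooth_action (orb_act O) &
      proper_action (orb_act O)].

(** A diffeomorphism of orbifolds is a homeomorphism of the underlying spaces
    that lifts, around each point, to a diffeomorphism of orbifold charts,
    equivariant for an isomorphism of the isotropy groups. *)
Definition orbifold_diffeo (O P : orbifold)
    (Phi : underlying_space O -> underlying_space P) : Prop :=
  [/\ continuous Phi,
      exists Psi, [/\ continuous Psi, cancel Phi Psi & cancel Psi Phi] &
      forall x : orb_cover O,
      exists (U : set (orb_cover O)) (V : set (orb_cover P))
        (f : orb_cover O -> orb_cover P) (theta : orb_group O -> orb_group P),
      [/\ U x, diffeo_on U V f &
          forall u, U u ->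
            Phi (orbit_pi (orb_act O) u) = orbit_pi (orb_act P) (f u)] /\
      [/\ set_bij (stabilizer (orb_act O) x) (stabilizer (orb_act P) (f x))
            theta,
          {in stabilizer (orb_act O) x &,
            {morph theta : g h / (g * h)%g}} &
          forall u g, U u -> stabilizer (orb_act O) x g ->
            U (orb_act O u g) /\
            f (orb_act O u g) = orb_act P (f u) (theta g)]].

Definition very_good_orbifold (O : orbifold) : Prop :=
  good_orbifold O /\
  exists (M : smoothSpace R) (G : finGroupType) (act : raction G M),
    let P := Orbifold act in
    good_orbifold P /\
    exists Phi : underlying_space P -> underlying_space O, orbifold_diffeo Phi.

End SmoothSpaces.

Section FlatMetrics.
Variables (R : realType) (n : nat) (Gamma : subgroup (Aff R n)).

Definition crystallographic : Prop :=
  [/\ Gamma `<=` @Iso R n,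
      forall g, subgroup_set Gamma g ->
        \forall h \near g, subgroup_set Gamma h -> h = g &
      compact [set: affine_quotient Gamma]].

Definition holonomy : set (GL R n) := [set tau g | g in Gamma].

Definition Cflat : set 'M[R]_n :=
  [set X | X \in unitmx /\
    forall h, holonomy h -> orthogonal (X *m \val h *m invmx X)].

Definition Cflat_space : smoothSpace R :=
  @sub_smooth R (euclid 'M[R]_n) Cflat.

Definition Nflat : subgroup (GL R n) :=
  image_subgroup (@tau R n) (normalizer Gamma).

Definition Tflat_rel : rel Cflat_space :=
  fun X Y => `[< exists2 Q, orthogonal Q & \val Y = Q *m \val X >].

Lemma Tflat_rel_equiv : equiv_class_of Tflat_rel.
Proof.
have OV (Q : 'M[R]_n) : orthogonal Q -> orthogonal Q^T.
  by rewrite /orthogonal /= trmxK => /mulmx1C.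
split=> [X|X Y|Y X Z].
- by apply/asboolP; exists 1%:M; rewrite ?mul1mx// /orthogonal/= trmx1 mul1mx.
- by apply/asbool_equiv_eq; split=> -[Q OQ XY]; exists Q^T;
    rewrite ?XY ?mulmxA ?OQ ?mul1mx//; exact: OV.
- move=> /asboolP[P OP XY] /asboolP[Q OQ YZ]; apply/asboolP.
  exists (Q *m P); last by rewrite YZ XY mulmxA.
  by rewrite /orthogonal/= trmx_mul mulmxA -(mulmxA P^T) OQ mulmx1.
Qed.
Canonical Tflat_equiv := EquivRelPack Tflat_rel_equiv.

Definition Tflat : smoothSpace R := quot_smooth Tflat_equiv.

Lemma Cflat_act_subproof (X : Cflat_space) (A : subgroup_type Nflat) :
  \val X *m \val (\val A) \in Cflat.
Proof.
have [uX CX] := set_mem (valP X); have [g Ng gA] := set_mem (valP A).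
have uA := GL_unit (\val A).
apply/mem_set; split; first by rewrite unitmx_mul uX.
move=> _ [h Gh <-].
have Gh' : subgroup_set Gamma (h ^ g^-1)%g.
  by apply/((normalizerP Gamma g).1 Ng); rewrite conjgKV.
have -> : \val X *m \val (\val A) *m \val (tau h) *m
    invmx (\val X *m \val (\val A)) =
    \val X *m \val (tau (h ^ g^-1)%g) *m invmx (\val X).
  rewrite -gA -[\val X]/(\val (toGL uX)) -val_GLM -val_GLV invgM.
  by rewrite /conjg invgK !tauM -!val_GLM -!val_GLV -!val_GLM !mulgA.
by apply: CX; exists (h ^ g^-1)%g.
Qed.

Definition Cflat_act (X : Cflat_space) (A : subgroup_type Nflat) :
  Cflat_space := exist (fun Y => Y \in Cflat) _ (Cflat_act_subproof X A).

Definition Tflat_repr (t : Tflat) : Cflat_space :=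
  generic_quotient.repr (t : {eq_quot Tflat_equiv}).

Lemma Tflat_reprK t : quot_pi Tflat_equiv (Tflat_repr t) = t.
Proof. exact: reprK. Qed.

(** The choice of representative is immaterial: see [Tflat_act_pi]. *)
Definition Tflat_act (t : Tflat) (A : subgroup_type Nflat) : Tflat :=
  quot_pi Tflat_equiv (Cflat_act (Tflat_repr t) A).

Lemma quot_pi_Tflat X Y :
  quot_pi Tflat_equiv X = quot_pi Tflat_equiv Y <->
  exists2 Q, orthogonal Q & \val Y = Q *m \val X.
Proof.
split=> [/eqmodP/asboolP//|XY].
by apply/(@eqmodP _ Tflat_equiv)/asboolP.
Qed.

Lemma Tflat_act_pi X A :
  Tflat_act (quot_pi Tflat_equiv X) A = quot_pi Tflat_equiv (Cflat_act X A).
Proof.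
have /quot_pi_Tflat[Q OQ QX] : quot_pi Tflat_equiv
    (Tflat_repr (quot_pi Tflat_equiv X)) = quot_pi Tflat_equiv X.
  by rewrite Tflat_reprK.
by apply/quot_pi_Tflat; exists Q => //=; rewrite QX mulmxA.
Qed.

Lemma quot_pi_Tflat_surj t : exists X, t = quot_pi Tflat_equiv X.
Proof. by exists (Tflat_repr t); rewrite Tflat_reprK. Qed.

Lemma Tflat_act1 t : Tflat_act t 1%g = t.
Proof.
have [X ->] := quot_pi_Tflat_surj t; rewrite Tflat_act_pi.
by congr quot_pi; apply/val_inj; rewrite /= mulmx1.
Qed.

Lemma Tflat_actM t A B :
  Tflat_act t (A * B)%g = Tflat_act (Tflat_act t A) B.
Proof.
have [X ->] := quot_pi_Tflat_surj t; rewrite !Tflat_act_pi.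
by congr quot_pi; apply/val_inj; rewrite /= mulmxA.
Qed.

Definition Tflat_raction : raction (subgroup_type Nflat) Tflat :=
  RAction Tflat_act1 Tflat_actM.

Definition Mflat : orbifold R := Orbifold Tflat_raction.

End FlatMetrics.

(* Main.v *)
Require Import Defs.
From HB Require Import structures.
From mathcomp Require Import all_boot all_order all_algebra fingroup.
From mathcomp Require Import all_classical all_reals all_analysis.
From mathcomp Require Import ring lra.

Set Implicit Arguments.
Unset Strict Implicit.
Unset Printing Implicit Defensive.

Import Order.TTheory GRing.Theory Num.Theory.
Import numFieldNormedType.Exports.

Local Open Scope classical_set_scope.
Local Open Scope quotient_scope.
Local Open Scope ring_scope.

(** Sending a matrix [X] to the form [X^T X] identifies the Teichmueller space
    with the positive definite forms that are invariant under the holonomy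
    group: an open cone in a vector space, hence a manifold with one chart
    ([Tflat_manifold]).  A smooth inverse of the chart is the Cholesky
    factorization ([Ck_chol]); that it is smooth, and that charts and actions
    are, comes down to the chain rule for functions of class [C^k] ([Ck_comp]).

    The translations contained in the crystallographic group form a lattice,
    which spans by the first Bieberbach theorem ([translation_basis]) and which
    the normalizer preserves.  The spanning rests on [small_rotation_trivial]:
    an element whose rotation is close to the identity is a translation.  A
    compact set of metrics is bounded above and below, so that the elements of
    the normalizer that move it to meet itself have bounded entries, and a
    lattice leaves room for only finitely many of them: the action is proper
    ([Tflat_proper]).

    The elements of the normalizer that act trivially on the lattice modulo 3
    form a normal subgroup of finite index ([level3_finite_index]), and this
    subgroup acts freely ([level3_free]).  That second fact is a lemma of
    Minkowski: if [A] fixes a metric then [(A - 1) / 3] maps the lattice to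
    itself and strictly shortens it, which forces [A = 1].

    Finally, let a group act smoothly and properly on a manifold, and let the
    kernel of a homomorphism onto a finite group act freely
    ([very_good_quotient]).  The quotient by the kernel is a manifold, and the
    finite group acts on it with the same orbifold quotient. *)

(** * Smooth functions on open sets of normed spaces *)

Section CkAlgebra.
Variables (R : realType) (V : normedModType R).
Implicit Types (U : set V) (f g : V -> R).

Lemma Ck_continuous k U f x : Ck k U f -> U x -> {for x, continuous f}.
Proof. by case: k => [|k] [cf _]; apply: cf. Qed.

Lemma Ck_le k U f : Ck k.+1 U f -> Ck k U f.
Proof.
elim: k f => [|k IH] f [cf [df Hf]]; first by split.
by split=> //; split=> // v; apply: IH.
Qed.

Lemma Ck_eq k U f g : open U -> (forall x, U x -> f x = g x) ->
  Ck k U f -> Ck k U g.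
Proof. by move=> oU; apply: CkS. Qed.

Lemma Ck_cst k U (c : R) : Ck k U (cst c).
Proof.
elim: k c => [|k IH] c; split=> //; try by move=> x _; exact: cst_continuous.
split=> [v x _|v]; first exact: derivable_cst.
have -> : 'D_v (cst c : V -> R) = cst 0.
  by apply/funext => x; rewrite derive_cst.
exact: IH.
Qed.

Lemma CkD k U f g : open U -> Ck k U f -> Ck k U g ->
  Ck k U (fun x => f x + g x).
Proof.
move=> oU; elim: k f g => [|k IH] f g [cf Hf] [cg Hg]; split.
- by move=> x Ux; exact: (cvgD (cf x Ux) (cg x Ux)).
- by [].
- by move=> x Ux; exact: (cvgD (cf x Ux) (cg x Ux)).
case: Hf Hg => df Hf [dg Hg]; split=> [v x Ux|v].
  exact: (derivableD (df v x Ux) (dg v x Ux)).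
apply: Ck_eq (IH _ _ (Hf v) (Hg v)) => // x Ux.
exact/esym/(deriveD (df v x Ux) (dg v x Ux)).
Qed.

Lemma CkM k U f g : open U -> Ck k U f -> Ck k U g ->
  Ck k U (fun x => f x * g x).
Proof.
move=> oU; elim: k f g => [|k IH] f g Cf Cg; split=> //.
- by move=> x Ux; exact: (cvgM (Ck_continuous Cf Ux) (Ck_continuous Cg Ux)).
- by move=> x Ux; exact: (cvgM (Ck_continuous Cf Ux) (Ck_continuous Cg Ux)).
have [_ [df Hf]] := Cf; have [_ [dg Hg]] := Cg; split=> [v x Ux|v].
  exact: (derivableM (df v x Ux) (dg v x Ux)).
have := CkD oU (IH _ _ (Ck_le Cf) (Hg v)) (IH _ _ (Ck_le Cg) (Hf v)).
apply: Ck_eq => // x Ux.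
exact/esym/(deriveM (df v x Ux) (dg v x Ux)).
Qed.

Lemma Ck_sum k U (I : Type) (s : seq I) (F : I -> V -> R) : open U ->
  (forall i, Ck k U (F i)) -> Ck k U (fun x => \sum_(i <- s) F i x).
Proof.
move=> oU CF; elim: s => [|i s IH].
  by apply: Ck_eq (Ck_cst k U 0) => // x _; rewrite big_nil.
by apply: Ck_eq (CkD oU (CF i) IH) => // x _; rewrite big_cons.
Qed.

Lemma CkN k U f : open U -> Ck k U f -> Ck k U (fun x => - f x).
Proof.
move=> oU Cf; apply: Ck_eq (CkM oU (Ck_cst k U (-1)) Cf) => // x _.
by rewrite /cst mulN1r.
Qed.

Lemma CkV k U f : open U -> (forall x, U x -> f x != 0) -> Ck k U f ->
  Ck k U (fun x => (f x)^-1).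
Proof.
move=> oU f0; elim: k => [|k IH] Cf; split=> //.
- by move=> x Ux; exact: (cvgV (f0 x Ux) (Ck_continuous Cf Ux)).
- by move=> x Ux; exact: (cvgV (f0 x Ux) (Ck_continuous Cf Ux)).
have [_ [df Hf]] := Cf; split=> [v x Ux|v].
  exact: (derivableV (f0 x Ux) (df v x Ux)).
have CV := IH (Ck_le Cf).
apply: Ck_eq (CkM oU (CkN oU (CkM oU CV CV)) (Hf v)) => // x Ux.
by rewrite (deriveV (f0 x Ux) (df v x Ux)) -exprVn expr2.
Qed.

(** The difference quotient of a square root is that of the radicand divided by
    [sqrt (f (x + h v)) + sqrt (f x)]. *)
Lemma is_derive_sqrt f x v : 0 < f x -> derivable f x v ->
  is_derive x v (fun y => Num.sqrt (f y)) ('D_v f x / (2 * Num.sqrt (f x))).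
Proof.
move=> fx0 df.
have cl : (f (h *: v + x) : R) @[h --> (0 : R)] --> f x.
  have /derivable1P/derivable1_diffP/differentiable_continuous := df.
  by rewrite /prop_for /continuous_at scale0r add0r.
have cd : (f (h *: v + x) : R) @[h --> (0 : R)^'] --> f x.
  by apply: cvg_trans cl; apply: cvg_app; exact: cvg_within.
suff H : h^-1 *: (Num.sqrt (f (h *: v + x)) - Num.sqrt (f x)) @[h --> (0:R)^']
    --> 'D_v f x / (2 * Num.sqrt (f x)).
  by apply: DeriveDef; [apply/cvg_ex; eexists; exact: H|exact: cvg_lim H].
have sx0 : 0 < Num.sqrt (f x) by rewrite sqrtr_gt0.
have cs : Num.sqrt (f (h *: v + x)) + Num.sqrt (f x) @[h --> (0 : R)^']
    --> 2 * Num.sqrt (f x).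
  rewrite mulr_natl mulr2n; apply: cvgD; last exact: cvg_cst.
  exact: (continuous_cvg _ (@sqrt_continuous R _) cd).
have cV : (Num.sqrt (f (h *: v + x)) + Num.sqrt (f x))^-1 @[h --> (0 : R)^']
    --> (2 * Num.sqrt (f x))^-1.
  by apply: cvgV => //; rewrite mulf_neq0// gt_eqF.
apply: cvg_trans (cvgM df cV); apply: near_eq_cvg; near=> h.
have fh0 : 0 < f (h *: v + x) by near: h; exact: (cvgr_gt (f x)).
have sh0 : 0 < Num.sqrt (f (h *: v + x)) by rewrite sqrtr_gt0.
have e : f (h *: v + x) - f x =
    (Num.sqrt (f (h *: v + x)) - Num.sqrt (f x)) *
    (Num.sqrt (f (h *: v + x)) + Num.sqrt (f x)).
  by rewrite -subr_sqr !sqr_sqrtr// ltW.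
rewrite /= e scalerAl mulfK// gt_eqF//.
exact: addr_gt0.
Unshelve. all: by end_near. Qed.

Lemma Ck_sqrt k U f : open U -> (forall x, U x -> 0 < f x) -> Ck k U f ->
  Ck k U (fun x => Num.sqrt (f x)).
Proof.
move=> oU f0; elim: k => [|k IH] Cf; split=> //.
- by move=> x Ux; exact: (continuous_cvg _ (@sqrt_continuous R _)
    (Ck_continuous Cf Ux)).
- by move=> x Ux; exact: (continuous_cvg _ (@sqrt_continuous R _)
    (Ck_continuous Cf Ux)).
have [_ [df Hf]] := Cf; split=> [v x Ux|v].
  by have [] := is_derive_sqrt (f0 x Ux) (df v x Ux).
have C2 := CkM oU (Ck_cst k U 2) (IH (Ck_le Cf)).
have n0 x : U x -> cst 2 x * Num.sqrt (f x) != 0.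
  by move=> Ux; rewrite mulf_neq0 /cst// gt_eqF// sqrtr_gt0 f0.
apply: Ck_eq (CkM oU (Hf v) (CkV oU n0 C2)) => // x Ux.
by have [_ ->] := is_derive_sqrt (f0 x Ux) (df v x Ux).
Qed.

Lemma Ck_linear k U (f : {linear V -> R}) : continuous f -> Ck k U f.
Proof.
move=> cf; case: k => [|k]; split=> //; try by move=> x _; exact: cf.
split=> [v x _|v]; first exact/diff_derivable/linear_differentiable.
have -> : 'D_v f = cst (f v); last exact: Ck_cst.
apply/funext => x; rewrite deriveE; last exact: linear_differentiable.
by rewrite diff_lin.
Qed.

End CkAlgebra.
Lemma continuous_sum (R : realType) (V : topologicalType)
    (W : normedModType R) (I : Type) (s : seq I) (f : I -> V -> W) :
  (forall i, continuous (f i)) -> continuous (fun x => \sum_(i <- s) f i x).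
Proof.
move=> cf x; apply: cvg_big => [|i _]; last exact: cf.
exact: add_continuous.
Qed.

Lemma continuous_mx (T U : topologicalType) m n (p : U -> 'M[T]_(m, n)) x :
  (forall i j, {for x, continuous (fun y => p y i j)}) -> {for x, continuous p}.
Proof.
move=> cp A [P Px PA]; apply: (@filterS _ _ _ _ _ (fun y => PA (p y))).
by apply: filter_forall => i; apply: filter_forall => j; exact/cp/Px.
Qed.

(** The mean value theorem on the segment from [z] to [z + s e]; the estimate is
    uniform in the base point [z], which is what the coordinatewise telescoping
    of [C1_differentiable] needs. *)
Lemma partial_increment (R : realType) (W : normedModType R) (O : set W)
    (F : W -> R) (e w : W) (eps : R) :
  0 < eps -> nbhs w O -> (forall y, O y -> derivable F y e) ->
  {for w, continuous ('D_e F)} ->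
  exists2 r : R, 0 < r & forall (z : W) (s : R), `|z - w| < r -> `|s| < r ->
    `|F (s *: e + z) - F z - s * 'D_e F w| <= eps * `|s|.
Proof.
move=> eps0 Ow dF cF.
have /nbhs_ballP[r0 /= r00 H] :
    nbhs w (O `&` [set y | `|'D_e F w - 'D_e F y| <= eps]).
  by apply: filterI => //; move/cvgrPdist_le: cF; apply.
have e1 : 0 < 1 + `|e| by rewrite ltr_pwDl.
exists (r0 / (1 + `|e|)); first exact: divr_gt0.
set r := r0 / _ => z s zw sr.
have inb (c : R) : `|c| < r -> ball w r0 (c *: e + z).
  move=> cr; rewrite -ball_normE /= -normrN opprB -addrA.
  apply: le_lt_trans (ler_normD _ _) _; rewrite normrZ.
  have -> : r0 = r * `|e| + r.
    by rewrite -{2}[r]mulr1 -mulrDr addrC divfK// gt_eqF.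
  by apply: ler_ltD => //; apply: ler_wpM2r => //; exact: ltW.
pose g (t : R) := F (t *: e + z).
have dg (c : R) : `|c| < r -> is_derive c 1 g ('D_e F (c *: e + z)).
  move=> cr; have [Oc _] := H _ (inb _ cr).
  have E : (fun h : R => h^-1 *: (g (h *: 1 + c) - g c)) =
      (fun h => h^-1 *: (F (h *: e + (c *: e + z)) - F (c *: e + z))).
    by apply/funext => h; rewrite /g addrA scalerDl [h%:A]mulr1.
  have := dF _ Oc; rewrite /derivable -E => dc.
  by apply: DeriveDef => //; rewrite /derive E.
have mvt (a b : R) : a <= b -> `|a| < r -> `|b| < r ->
    `|g b - g a - (b - a) * 'D_e F w| <= eps * (b - a).
  move=> ab ar br.
  have inab c : c \in `[a, b] -> `|c| < r.
    rewrite in_itv /= => /andP[ac cb]; rewrite ltr_norml.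
    move: ar br; rewrite !ltr_norml => /andP[ar _] /andP[_ br].
    by rewrite (lt_le_trans ar ac) (le_lt_trans cb br).
  have [|c cab ->] := MVT_segment ab (fun c (Hc : c \in `]a, b[) =>
      dg c (inab c (subset_itv_oo_cc Hc))).
    by apply: derivable_within_continuous => c /inab/dg[].
  rewrite mulrC -mulrBr normrM mulrC [`|b - a|]ger0_norm ?subr_ge0//.
  apply: ler_wpM2r; first by rewrite subr_ge0.
  by rewrite distrC; have [_] := H _ (inb _ (inab _ cab)).
have r0' : `|0 : R| < r by rewrite normr0 divr_gt0.
have g0 : F z = g 0 by rewrite /g scale0r add0r.
have [s0|s0] := leP 0 s.
  by have := mvt _ _ s0 r0' sr; rewrite g0 subr0 (ger0_norm s0).
have := mvt _ _ (ltW s0) sr r0'; rewrite sub0r (ltr0_norm s0) g0.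
by rewrite -[X in X <= _ -> _]normrN opprB mulNr opprB addrC.
Qed.

Section ChainRule.
Variables (R : realType) (m n : nat).
Notation W := 'M[R]_(m, n).
Let E (p : 'I_m * 'I_n) : W := delta_mx p.1 p.2.

(** The increment of [F] is telescoped along the coordinates: each step moves
    along one coordinate, from a base point that tends to [w] with the
    increment. *)
Lemma C1_differentiable (O : set W) (F : W -> R) (w : W) :
  nbhs w O -> (forall v y, O y -> derivable F y v) ->
  (forall v, {for w, continuous ('D_v F)}) -> differentiable F w.
Proof.
move=> Ow dF cF.
pose C : W := \matrix_(i, j) 'D_(E (i, j)) F w.
pose df : {linear W -> R} := [the {linear W -> R} of mxtrace \o mulmx C^T].
have dfE h : df h = \sum_p h p.1 p.2 * 'D_(E p) F w.
  rewrite /df /= /mxtrace.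
  under [LHS]eq_bigr do rewrite mxE.
  rewrite exchange_big pair_bigA /=; apply: eq_bigr => -[i j] _ /=.
  by rewrite !mxE mulrC.
have cdf : continuous df.
  have -> : df = (fun h : W => \sum_p h p.1 p.2 * 'D_(E p) F w) :> (W -> R).
    exact/funext.
  apply: continuous_sum => p x.
  exact: (cvgMl (@coord_continuous R m n p.1 p.2 x)).
have cpart (s : seq ('I_m * 'I_n)) :
    continuous (fun h : W => \sum_(p <- s) h p.1 p.2 *: E p).
  apply: continuous_sum => p x.
  exact: (cvgZl (@coord_continuous R m n p.1 p.2 x)).
have tele (s : seq ('I_m * 'I_n)) (eps : R) : 0 < eps ->
    \forall h \near (0 : W),
    `|F (\sum_(p <- s) (h : W) p.1 p.2 *: E p + w) - F w -
      \sum_(p <- s) h p.1 p.2 * 'D_(E p) F w| <= eps * `|h|.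
  elim: s eps => [|p s IH] eps eps0.
    near=> h; rewrite !big_nil add0r subrr subr0 normr0.
    by rewrite mulr_ge0// ltW.
  have eps20 : 0 < eps / 2 by rewrite divr_gt0.
  have [r r0 step] := partial_increment eps20 Ow (dF (E p)) (cF (E p)).
  have Hz : \forall h \near (0 : W),
      `|\sum_(q <- s) (h : W) q.1 q.2 *: E q| < r.
    have := cpart s 0; rewrite /continuous_at big1 => [|q _].
      by move=> /cvgr0Pnorm_lt; apply.
    by rewrite mxE scale0r.
  near=> h; rewrite !big_cons.
  set z := \sum_(q <- s) _; set y := \sum_(q <- s) _.
  have hp : `|h p.1 p.2| <= `|h|.
    rewrite [leRHS]/Num.Def.normr/= mx_normrE.
    exact: (le_bigmax _ _ (p.1, p.2)).
  have -> : F (h p.1 p.2 *: E p + z + w) - F w -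
      (h p.1 p.2 * 'D_(E p) F w + y) =
      (F (h p.1 p.2 *: E p + (z + w)) - F (z + w) - h p.1 p.2 * 'D_(E p) F w) +
      (F (z + w) - F w - y).
    by rewrite -(addrA _ z w); ring.
  apply: le_trans (ler_normD _ _) _; rewrite (splitr eps) mulrDl; apply: lerD.
    apply: (@le_trans _ _ (eps / 2 * `|h p.1 p.2|)); last first.
      by apply: ler_wpM2l => //; exact: ltW.
    apply: step.
      by rewrite addrK /z; near: h; exact: Hz.
    apply: le_lt_trans hp _; near: h.
    exact: (@nbhs0_lt R W r r0).
  rewrite /z /y; near: h. exact: (IH _ eps20).
apply/diff_locallyP.
have Eo : (F \o shift w : W -> R) =
    cst (F w) + (df : W -> R) +o_ (0 : W) (id : W -> W).
  apply/(@eqaddoP R W R W) => eps eps0.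
  have := tele (index_enum _) eps eps0; apply: filterS => h.
  rewrite -dfE -(pair_bigA _ (fun i j => h i j *: delta_mx i j)) /=.
  by rewrite -matrix_sum_delta -addrA -opprD.
by rewrite (diff_unique cdf Eo).
Unshelve. all: by end_near. Qed.

Lemma is_derive_comp_C1 (V : normedModType R) (O : set W) (F : W -> R)
    (p : V -> W) (x v : V) :
  nbhs (p x) O -> (forall v y, O y -> derivable F y v) ->
  (forall v, {for p x, continuous ('D_v F)}) ->
  (forall i j, derivable (fun y => p y i j) x v) ->
  is_derive x v (F \o p) (\sum_i \sum_j
     'D_(delta_mx i j) F (p x) * 'D_v (fun y => p y i j) x).
Proof.
move=> Op dF cF /derivable_mxP dp.
have DF := C1_differentiable Op dF cF.
pose l := fun h : R => p (h *: v + x).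
have dl : differentiable l 0.
  exact: ((derivable1_diffP l 0).1 ((derivable1P p x v).1 dp)).
have l0 : l 0 = p x by rewrite /l scale0r add0r.
have dFl : differentiable (F \o l) 0.
  by apply: differentiable_comp; rewrite ?l0.
have ag (T : normedModType R) (G : V -> T) :
    'D_v G x = 'D_1 (fun h : R => G (h *: v + x)) 0.
  rewrite /derive; set g1 := fun h => h^-1 *: _; set g2 := fun h => h^-1 *: _.
  suff -> : g1 = g2 by []; apply/funext => h; rewrite /g1 /g2 /=.
  by rewrite addr0 scale0r add0r [h%:A]mulr1.
have dFp : derivable (F \o p) x v :=
  (derivable1P _ _ _).2 ((derivable1_diffP _ _).2 dFl).
apply: DeriveDef => //.
transitivity ('D_1 (F \o l) 0); first exact: ag.
rewrite deriveE// diff_comp ?l0//=.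
have -> : 'd l (0 : R) (1 : R) = 'D_1 l 0 by rewrite deriveE.
have -> : 'D_1 l 0 = 'D_v p x by exact/esym/ag.
rewrite derive_mx//.
rewrite [X in 'd F _ X]matrix_sum_delta !linear_sum; apply: eq_bigr => i _.
rewrite linear_sum; apply: eq_bigr => j _.
by rewrite linearZ /= mxE -deriveE//; exact: mulrC.
Qed.

(** The directional derivatives of [F \o p] are sums of products of derivatives
    of [F] along [p] with derivatives of the entries of [p], to which the
    induction hypothesis applies. *)
Lemma Ck_comp (V : normedModType R) k (U : set V) (O : set W) (F : W -> R)
    (p : V -> W) :
  open U -> open O -> (forall x, U x -> O (p x)) -> Ck k O F ->
  (forall i j, Ck k U (fun x => p x i j)) -> Ck k U (F \o p).
Proof.
move=> oU oO UO; elim: k F => [|k IH] F CF Cp.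
all: have cp x (Ux : U x) : {for x, continuous p} :=
  continuous_mx (fun i j => Ck_continuous (Cp i j) Ux).
all: split; [|try exact I].
1, 2: move=> x Ux.
1, 2: exact: (continuous_comp (cp _ Ux) (Ck_continuous CF (UO _ Ux))).
have [_ [dF HF]] := CF.
have D x v : U x -> is_derive x v (F \o p) (\sum_i \sum_j
     'D_(delta_mx i j) F (p x) * 'D_v (fun y => p y i j) x).
  move=> Ux; apply: (@is_derive_comp_C1 _ O).
  - exact: open_nbhs_nbhs (conj oO (UO x Ux)).
  - by move=> u y; apply: dF.
  - by move=> u; exact: Ck_continuous (HF u) (UO x Ux).
  - by move=> i j; have [_ [+ _]] := Cp i j; apply.
split=> [v x Ux|v]; first by have [] := D x v Ux.
have : Ck k U (fun x => \sum_i \sum_j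
    ('D_(delta_mx i j) F \o p) x * 'D_v (fun y => p y i j) x).
  apply: Ck_sum => // i; apply: Ck_sum => // j; apply: CkM => //.
    by apply: IH => [|i' j']; [exact: HF|exact: Ck_le (Cp i' j')].
  by have [_ [_ +]] := Cp i j; apply.
by apply: Ck_eq => // x Ux; have [_ ->] := D x v Ux.
Qed.

End ChainRule.
(** * Positive definite matrices and their Cholesky factors *)

Section PosDef.
Variable R : realType.

Definition qform n (S : 'M[R]_n) (v : 'rV[R]_n) : R := (v *m S *m v^T) 0 0.

Definition posdef n (S : 'M[R]_n) : Prop :=
  S^T = S /\ forall v, v != 0 -> 0 < qform S v.

Lemma qformE n (S : 'M[R]_n) v :
  qform S v = \sum_i \sum_j v 0 j * S j i * v 0 i.
Proof.
rewrite /qform mxE; apply: eq_bigr => i _; rewrite !mxE big_distrl /=.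
by apply: eq_bigr.
Qed.

Lemma qformZ n (S : 'M[R]_n) a v : qform S (a *: v) = a ^+ 2 * qform S v.
Proof.
by rewrite /qform linearZ /= -!scalemxAl -scalemxAr scalerA mxE -expr2 /qform.
Qed.

Lemma qform_gram m n (X : 'M[R]_(m, n)) v :
  qform (X^T *m X) v = \sum_i ((v *m X^T) 0 i) ^+ 2.
Proof.
rewrite /qform mulmxA -mulmxA -[X in _ *m (X *m _)]trmxK -trmx_mul mxE.
by apply: eq_bigr => i _; rewrite [X in _ * X]mxE expr2.
Qed.

Lemma unitmx_inj n (A : 'M[R]_n) :
  (forall v : 'rV_n, v *m A = 0 -> v = 0) -> A \in unitmx.
Proof.
move=> Av; rewrite -row_free_unit -kermx_eq0; apply/eqP/row_matrixP => i.
by rewrite row0; apply: Av; apply/sub_kermxP/row_sub.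
Qed.

Lemma posdef_gram n (X : 'M[R]_n) : X \in unitmx -> posdef (X^T *m X).
Proof.
move=> uX; split=> [|v v0]; first by rewrite trmx_mul trmxK.
rewrite qform_gram lt_neqAle sumr_ge0 ?andbT => [|i _]; last exact: sqr_ge0.
apply: contra v0 => /eqP/esym/psumr_eq0P H.
have : v *m X^T = 0.
  apply/rowP => i; rewrite [RHS]mxE; apply/eqP; rewrite -sqrf_eq0.
  by apply/eqP/H => // j _; exact: sqr_ge0.
move/(congr1 (mulmx^~ (invmx X^T))).
by rewrite mul0mx mulmxK ?unitmx_tr// => ->.
Qed.

Lemma gram_unit n (X S : 'M[R]_n) : posdef S -> X^T *m X = S -> X \in unitmx.
Proof.
move=> [_ pS] XS; rewrite -unitmx_tr; apply: unitmx_inj => v vX.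
apply/eqP; apply: contraTT (isT : true) => /pS.
by rewrite -XS /qform mulmxA vX !mul0mx mxE ltxx.
Qed.

(** The upper triangular factor of the block decomposition with a 1x1 pivot;
    the only non-rational operation is the square root of the pivot, so that
    the factor depends smoothly on the matrix. *)
Fixpoint chol n : 'M[R]_n -> 'M[R]_n :=
  match n with
  | 0 => id
  | n'.+1 => fun S : 'M[R]_(1 + n') =>
      let p := S 0 0 in let q := ursubmx S in
      block_mx (Num.sqrt p)%:M ((Num.sqrt p)^-1 *: q) 0
        (chol (drsubmx S - p^-1 *: (q^T *m q)))
  end.

Section Schur.
Variables (n : nat) (S : 'M[R]_(1 + n)).
Hypothesis pS : posdef S.
Let p := S 0 0.
Let q := ursubmx S.

Lemma pivot_gt0 : 0 < p.
Proof.
have [_ /(_ (delta_mx 0 0))] := pS; rewrite /qform -rowE trmx_delta -colE !mxE.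
apply; apply/negP => /eqP/rowP/(_ 0); rewrite !mxE !eqxx => /eqP.
by rewrite oner_eq0.
Qed.

Lemma ul_pivot : ulsubmx S = p%:M.
Proof.
by apply/matrixP => i j; rewrite !ord1 !mxE eqxx mulr1n; congr (S _ _);
  exact/val_inj.
Qed.

Lemma dl_pivot : dlsubmx S = q^T.
Proof. by rewrite /q trmx_ursub; have [-> _] := pS. Qed.

(** The Schur complement of the pivot takes at [v] the value that [S] takes at
    the vector over [v] that is orthogonal, for [S], to the first axis. *)
Lemma posdef_schur : posdef (drsubmx S - p^-1 *: (q^T *m q)).
Proof.
have p0 : p != 0 by rewrite gt_eqF// pivot_gt0.
split=> [|v v0].
  rewrite linearB linearZ /= trmx_mul trmxK trmx_drsub.
  by have [-> _] := pS.
pose w : 'rV[R]_(1 + n) := row_mx (- p^-1 *: (v *m q^T)) v.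
have w0 : w != 0.
  apply: contra v0 => /eqP/(congr1 rsubmx).
  by rewrite row_mxKr linear0 => ->.
have [_ /(_ w w0)] := pS; congr (0 < _).
rewrite /qform -[S in LHS]submxK ul_pivot dl_pivot -/q tr_row_mx mul_row_block.
rewrite mul_row_col mul_mx_scalar scalerA mulrN mulfV// scaleN1r addNr.
rewrite mul0mx add0r.
congr ((_ *m _) 0 0).
by rewrite mulmxBr -scalemxAl -scalemxAr mulmxA scaleNr addrC.
Qed.

End Schur.

Lemma cholS n (S : 'M[R]_(1 + n)) :
  chol S = block_mx (Num.sqrt (S 0 0))%:M ((Num.sqrt (S 0 0))^-1 *: ursubmx S) 0
    (chol (drsubmx S - (S 0 0)^-1 *: ((ursubmx S)^T *m ursubmx S))).
Proof. by []. Qed.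

Lemma chol_gram n (S : 'M[R]_n) : posdef S -> (chol S)^T *m chol S = S.
Proof.
elim: n S => [|n IH] S pS; first by apply/matrixP => -[].
suff: forall C : 'M[R]_(1 + n), C = chol S -> C^T *m C = S by apply.
move=> _ ->; rewrite cholS tr_block_mx mulmx_block.
rewrite !trmx0 !mul0mx !mulmx0 !addr0.
rewrite IH; last exact: posdef_schur.
have p0 := pivot_gt0 pS; have s0 : 0 < Num.sqrt (S 0 0) by rewrite sqrtr_gt0.
have sp : Num.sqrt (S 0 0) * Num.sqrt (S 0 0) = S 0 0.
  by rewrite -expr2 sqr_sqrtr// ltW.
rewrite tr_scalar_mx -scalar_mxM sp mul_scalar_mx scalerA.
rewrite mulfV ?gt_eqF// scale1r.
rewrite mul_mx_scalar linearZ /= scalerA mulfV ?gt_eqF// scale1r.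
rewrite -scalemxAl -scalemxAr scalerA -invfM sp addrC subrK.
by rewrite -(dl_pivot pS) -ul_pivot submxK.
Qed.

Lemma chol_unit n (S : 'M[R]_n) : posdef S -> chol S \in unitmx.
Proof. by move=> pS; exact: gram_unit pS (chol_gram pS). Qed.

Lemma Ck_chol (V : normedModType R) k (U : set V) n (P : V -> 'M[R]_n) :
  open U -> (forall x, U x -> posdef (P x)) ->
  (forall i j, Ck k U (fun x => P x i j)) ->
  forall i j, Ck k U (fun x => chol (P x) i j).
Proof.
move=> oU; elim: n P => [|n IH] P pP CP; first by case.
have Cp := CP 0 0.
have p0 x : U x -> 0 < P x 0 0 by move=> /pP; exact: pivot_gt0.
have Cs := Ck_sqrt oU p0 Cp.
have s0 x : U x -> Num.sqrt (P x 0 0) != 0.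
  by move=> Ux; rewrite gt_eqF// sqrtr_gt0 p0.
have n0 x : U x -> P x 0 0 != 0 by move=> /p0; exact: lt0r_neq0.
suff H (i j : 'I_(1 + n)) : Ck k U (fun x => (chol (P x) : 'M[R]_(1 + n)) i j).
  exact: H.
case: (split_ordP i) => i' ->; case: (split_ordP j) => j' ->.
- apply: Ck_eq Cs => // x Ux.
  by rewrite cholS block_mxEul !ord1 mxE eqxx mulr1n.
- have C := CkM oU (CkV oU s0 Cs) (CP (lshift n i') (rshift 1 j')).
  apply: Ck_eq C => // x Ux.
  by rewrite cholS block_mxEur !mxE.
- apply: Ck_eq (Ck_cst k U 0) => // x Ux.
  by rewrite cholS block_mxEdl mxE.
pose q x := ursubmx (P x : 'M[R]_(1 + n)).
have := IH (fun x => drsubmx (P x : 'M[R]_(1 + n)) -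
  (P x 0 0)^-1 *: ((q x)^T *m q x)).
move=> /(_ (fun x Ux => posdef_schur (pP x Ux))) H.
apply: Ck_eq (H _ i' j') => // [x Ux|a b]; first by rewrite cholS block_mxEdr.
pose o : 'I_(1 + n) := lshift n (0 : 'I_1).
have C := CkD oU (CP (rshift 1 a) (rshift 1 b)) (CkN oU (CkM oU (CkV oU n0 Cp)
  (CkM oU (CP o (rshift 1 a)) (CP o (rshift 1 b))))).
apply: Ck_eq C => // x Ux; rewrite !mxE big_ord1 !mxE; congr (_ - _ * (_ * _)).
Qed.

Lemma qform_continuous n :
  continuous (fun z : 'rV[R]_n * 'M[R]_n => qform z.2 z.1).
Proof.
have -> : (fun z : 'rV[R]_n * 'M[R]_n => qform z.2 z.1) =
    (fun z => \sum_i \sum_j z.1 0 j * z.2 j i * z.1 0 i).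
  by apply/funext => z; rewrite qformE.
apply: continuous_sum => i; apply: continuous_sum => j z.
have c1 k : {for z, continuous (fun z : 'rV[R]_n * 'M[R]_n => z.1 0 k)}.
  apply: (@continuous_comp _ _ _ fst (fun v : 'rV[R]_n => v 0 k)).
    exact: cvg_fst.
  exact: coord_continuous.
apply: cvgM; last exact: c1.
apply: cvgM; first exact: c1.
apply: (@continuous_comp _ _ _ snd (fun S : 'M[R]_n => S j i)).
  exact: cvg_snd.
exact: coord_continuous.
Qed.

Let sphere n : set 'rV[R]_n := [set v | `|v| = 1].

Lemma compact_sphere n : compact (@sphere n).
Proof.
apply: bounded_closed_compact.
  exists 1; split=> // M M1 v; rewrite /sphere /= => ->; exact: ltW.
have /continuous_closedP/(_ [set 1]) : continuous (fun v : 'rV[R]_n => `|v|).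
  exact: norm_continuous.
by apply; exact: closed_eq.
Qed.

Lemma posdefP n (S : 'M[R]_n) :
  (forall v, sphere v -> 0 < qform S v) -> forall v, v != 0 -> 0 < qform S v.
Proof.
move=> pS v v0; have nv : 0 < `|v| by rewrite normr_gt0.
have : sphere (`|v|^-1 *: v).
  by rewrite /sphere/= normrZ ger0_norm ?invr_ge0// mulVf// gt_eqF.
by move=> /pS; rewrite qformZ pmulr_rgt0// exprn_gt0// invr_gt0.
Qed.

(** Positivity need only be tested on the unit sphere, whose compactness makes
    it an open condition. *)
Lemma posdef_near n (S : 'M[R]_n) : posdef S ->
  \forall T \near S, forall v, v != 0 -> 0 < qform T v.
Proof.
move=> [_ pS].
have /compact_near_coveringP := @compact_sphere n.
move=> /(_ _ (nbhs S) (fun T v => 0 < qform T v) _) H.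
have : \forall T \near S, @sphere n `<=` (fun v => 0 < qform T v).
  apply: H => v Sv.
  apply: (cvgr_gt _ (@qform_continuous n (v, S))); apply: pS.
  by rewrite -normr_gt0; move: Sv; rewrite /sphere /= => ->.
by apply: filterS => T /posdefP.
Qed.

Lemma compact_posdef_lower n (K : set 'M[R]_n) : compact K ->
  (forall S, K S -> posdef S) ->
  exists2 c : R, 0 < c & forall S v, K S -> c * `|v| ^+ 2 <= qform S v.
Proof.
move=> cK pK.
have cP := compact_setX (@compact_sphere n) cK.
have [[z Hz]|none] := pselect ((@sphere n `*` K) !=set0).
  have [[v S] /set_mem[/= Sv KS] m] := compact_EVT_min (ex_intro _ z Hz) cP
    (continuous_subspaceT (@qform_continuous n)).
  have v0 : v != 0 by rewrite -normr_gt0; move: Sv; rewrite /sphere /= => ->.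
  have [_ /(_ _ v0) qv] := pK _ KS.
  exists (qform S v) => // T w KT.
  have [->|w0] := eqVneq w 0.
    by rewrite normr0 expr0n mulr0 /qform !mul0mx mxE.
  have nw : 0 < `|w| by rewrite normr_gt0.
  have /= := m (`|w|^-1 *: w, T).
  rewrite qformZ exprVn ler_pdivlMl ?exprn_gt0//.
  rewrite [_ * `|w| ^+ 2]mulrC; apply; rewrite inE; split=> //=.
  by rewrite /sphere/= normrZ ger0_norm ?invr_ge0// mulVf// gt_eqF.
exists 1 => // S v KS; have [->|v0] := eqVneq v 0.
  by rewrite normr0 expr0n mulr0 /qform !mul0mx mxE.
case: none; exists (`|v|^-1 *: v, S); split=> //.
by rewrite /sphere/= normrZ ger0_norm ?invr_ge0// mulVf// gt_eqF// normr_gt0.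
Qed.

End PosDef.
(** * Diffeomorphisms and manifolds *)

Section Smooth.
Variable R : realType.
Implicit Types M N P : smoothSpace R.

Lemma smooth_map_comp M N P (f : M -> N) (g : N -> P) x :
  smooth_map_at f x -> smooth_map_at g (f x) -> smooth_map_at (g \o f) x.
Proof.
move=> [cf sf] [cg sg]; split; first exact: continuous_comp cf cg.
by move=> h sh; apply: (sf (h \o g)); exact: sg.
Qed.

Lemma nbhs_preimage (X Y : topologicalType) (f : X -> Y) x (A : set Y) :
  {for x, continuous f} -> nbhs (f x) A -> nbhs x (f @^-1` A).
Proof. exact. Qed.

Lemma open_preimage_on (X Y : topologicalType) (f : X -> Y) (U : set X)
    (O : set Y) :
  open U -> (forall x, U x -> {for x, continuous f}) -> open O ->
  open (U `&` f @^-1` O).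
Proof.
move=> oU cf oO; rewrite openE => x [Ux Ofx]; rewrite /interior.
apply: filterI; first exact: open_nbhs_nbhs (conj oU Ux).
by apply: (cf x Ux); exact: open_nbhs_nbhs (conj oO Ofx).
Qed.

Lemma diffeo_comp M N P (f : M -> N) (g : N -> P) U V V' W :
  diffeo_on U V f -> diffeo_on V' W g ->
  exists Z, diffeo_on (U `&` f @^-1` V') Z (g \o f).
Proof.
move=> [oU oV [f' [fU f'V sf sf']]] [oV' oW [g' [gV g'W sg sg']]].
exists (W `&` g' @^-1` V); split.
- by apply: open_preimage_on => // x Ux; have [_ []] := sf x Ux.
- by apply: open_preimage_on => // x Ux; have [_ []] := sg' x Ux.
exists (f' \o g'); split.
- move=> x [Ux Vx]; split; first exact: gV.
  by rewrite /= (sg _ Vx).1; exact: fU.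
- move=> y [Wy Vy]; split; first exact: f'V.
  by rewrite /= (sf' _ Vy).1; exact: g'W.
- move=> x [Ux Vx]; rewrite /= (sg _ Vx).1 (sf _ Ux).1; split=> //.
  exact: smooth_map_comp (sf _ Ux).2 (sg _ Vx).2.
- move=> y [Wy Vy]; rewrite /= (sf' _ Vy).1 (sg' _ Wy).1; split=> //.
  exact: smooth_map_comp (sg' _ Wy).2 (sf' _ Vy).2.
Qed.

(** Charts transport small closed balls. *)
Lemma manifold_locally_compact M : smooth_manifold M ->
  forall x : M, exists2 K : set M, nbhs x K & compact K.
Proof.
move=> [_ _ [d charts]] x; have [U [V [f [Ux]]]] := charts x.
move=> [oU oV [f' [fU f'V sf sf']]].
have /nbhs_ballP[r /= r0 rV] : nbhs (f x : 'rV[R]_d) V.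
  by apply: open_nbhs_nbhs; split=> //; exact: fU.
pose C : set 'rV[R]_d := closed_ball (f x : 'rV[R]_d) (r / 2).
have r20 : 0 < r / 2 by rewrite divr_gt0.
have CV : C `<=` V.
  move=> y; rewrite /C closed_ballE// => Cy; apply: rV; rewrite -ball_normE /=.
  by apply: le_lt_trans Cy _; rewrite ltr_pdivrMr// ltr_pMr// ltr1n.
have cC : compact C.
  apply: bounded_closed_compact; last exact: closed_ball_closed.
  exists (`|f x : 'rV[R]_d| + r / 2); split=> [|z rz y]; first exact: num_real.
  rewrite /C closed_ballE// => Cy; apply: le_trans (ltW rz).
  rewrite -(subrK (f x : 'rV[R]_d) y) addrC; apply: le_trans (ler_normD _ _) _.
  by rewrite lerD2l distrC.
have ballC (y : 'rV[R]_d) : nbhs y (closed_ball y (r / 2)).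
  apply: (@filterS _ _ _ (ball y (r / 2))); first exact: subset_closed_ball.
  exact: nbhsx_ballx.
have fxC : nbhs (f x) C by exact: ballC (f x).
exists (f' @` C); last first.
  apply: continuous_compact => //; apply: continuous_in_subspaceT => y.
  by rewrite inE => /CV Vy; have [_ []] := sf' y Vy.
have [fx [cf _]] := sf x Ux.
have : nbhs x (U `&` f @^-1` C).
  apply: filterI; first exact: open_nbhs_nbhs (conj oU Ux).
  exact: nbhs_preimage cf fxC.
apply: filterS => z [Uz Cz]; exists (f z) => //.
by have [] := sf z Uz.
Qed.

End Smooth.

(** * Proper actions *)

Lemma filter_finite (T : Type) (F : set_system T) (I : choiceType) (S : set I)
    (P : I -> set T) : Filter F -> finite_set S ->
  (forall i, S i -> F (P i)) -> F [set t | forall i, S i -> P i t].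
Proof.
move=> FF /finite_seqP[s ->]; elim: s => [|i s IH] FP.
  by apply: filterS filterT.
have : F (P i `&` [set t | forall j, j \in s -> P j t]).
  apply: filterI; first by apply: FP; rewrite /= mem_head.
  by apply: IH => j js; apply: FP; rewrite /= inE js orbT.
apply: filterS => t [Pi Ps] j; rewrite /= inE => /orP[/eqP->//|].
exact: Ps.
Qed.

Section ProperActions.
Variables (G : groupType) (X : topologicalType) (act : raction G X).
Hypothesis cact : forall g, continuous (act^~ g).

Lemma ractK g : cancel (act^~ g) (act^~ g^-1%g).
Proof. by move=> x; rewrite -ractM mulgV ract1. Qed.

Lemma ractKV g : cancel (act^~ g^-1%g) (act^~ g).
Proof. by move=> x; rewrite -ractM mulVg ract1. Qed.

Hypothesis hX : hausdorff_space X.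
Hypothesis lcX : forall x : X, exists2 K : set X, nbhs x K & compact K.
Hypothesis pact : proper_action act.

(** On compact neighbourhoods of [x] and [y] only finitely many group elements
    matter; those that do not send [x] to [y] are excluded one by one. *)
Lemma proper_separation x y : exists A B : set X,
  [/\ open_nbhs x A, open_nbhs y B &
      forall z w g, A z -> B w -> act z g = w -> act x g = y].
Proof.
have [K xK cK] := lcX x; have [L yL cL] := lcX y.
have finS := pact (compactU cK cL); set S := [set g | _] in finS.
have : nbhs (x, y) [set zw : X * X | forall g, S g ->
    act zw.1 g = zw.2 -> act x g = y].
  apply: filter_finite => // g _.
  have [->|ne] := eqVneq (act x g) y; first exact: filterE.
  move: hX; rewrite open_hausdorff => /(_ _ _ ne)[[Q1 Q2] /= [/set_mem xO yO]].
  move/set_mem in yO; move=> [oQ1 oQ2 /eqP Q12].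
  exists (act^~ g @^-1` Q1, Q2) => /=.
    split; last exact: open_nbhs_nbhs (conj oQ2 yO).
    by apply: cact; exact: open_nbhs_nbhs (conj oQ1 xO).
  move=> [z w] /= [zO wO] zgw; have : (Q1 `&` Q2) w by split=> //; rewrite -zgw.
  by rewrite Q12.
move=> [[A' B'] /= [xA yB] AB].
have : nbhs x (A' `&` K) by exact: filterI.
have : nbhs y (B' `&` L) by exact: filterI.
rewrite !nbhsE => -[B oB sB] [A oA sA]; exists A, B; split=> // z w g Az Bw zgw.
have [A'z Kz] := sA _ Az; have [B'w Lw] := sB _ Bw.
apply: (AB (z, w)) (zgw) => //.
rewrite /S /=; exists w; split; last exact: or_intror.
by exists z => //; exact: or_introl.
Qed.

Lemma finite_stabilizer x : finite_set (stabilizer act x).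
Proof.
apply: sub_finite_set (pact (@compact_set1 _ x)) => g gx.
by exists x; split=> //; exists x.
Qed.

(** The points all of whose translates by the finite stabilizer of [x] stay in a
    neighbourhood given by [proper_separation]. *)
Lemma slice x : exists V : set X,
  [/\ open_nbhs x V,
      forall v g, V v -> V (act v g) -> stabilizer act x g &
      forall v g, stabilizer act x g -> V v -> V (act v g)].
Proof.
have [A [B [[oA xA] [oB xB] AB]]] := proper_separation x x.
pose V := [set v | forall s, stabilizer act x s -> (A `&` B) (act v s)].
have sub v : V v -> A v /\ B v.
  by move=> /(_ 1%g); rewrite /stabilizer /= !ract1; apply.
exists V; split=> [|v g /sub[Av _] /sub[_ Bv]|v g gx Vv s sx].
- split; last by move=> s ->.
  rewrite openE => v Vv; apply: filter_finite => [|s sx].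
    exact: finite_stabilizer.
  apply: cact; apply: open_nbhs_nbhs; split; first exact: openI.
  exact: Vv.
- exact: (AB v (act v g)).
by rewrite -ractM; apply: Vv; rewrite /stabilizer /= ractM gx.
Qed.

End ProperActions.
(** * Very good quotients *)

Section VeryGoodQuotient.
Variables (R : realType) (T : smoothSpace R) (N : groupType).
Variables (act : raction N T) (G : finGroupType) (phi : N -> G).
Hypothesis mT : smooth_manifold T.
Hypothesis sact : smooth_action act.
Hypothesis pact : proper_action act.
Hypothesis phiM : {morph phi : a b / (a * b)%g}.
Hypothesis phi_surj : forall g, exists a, phi a = g.
Hypothesis phi_free : forall a t, phi a = 1%g -> act t a = t -> a = 1%g.

Lemma phi1 : phi 1%g = 1%g.
Proof. by apply: (mulgI (phi 1%g)); rewrite -phiM !mulg1. Qed.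

Lemma phiV a : phi a^-1%g = (phi a)^-1%g.
Proof. by apply: (mulgI (phi a)); rewrite -phiM !mulgV phi1. Qed.

Let cact a : continuous (act^~ a).
Proof. by move=> t; have [] := sact a t. Qed.

Let hT : hausdorff_space T. Proof. by case: mT. Qed.
Let lcT := manifold_locally_compact mT.

Definition ker_rel : rel T :=
  fun x y => `[< exists2 a, phi a = 1%g & y = act x a >].

Lemma ker_rel_equiv : equiv_class_of ker_rel.
Proof.
split=> [x|x y|y x z].
- by apply/asboolP; exists 1%g; rewrite ?phi1 ?ract1.
- by apply/asbool_equiv_eq; split=> -[a a1 ->]; exists a^-1%g;
    rewrite ?phiV ?a1 ?invg1 -?ractM ?mulgV ?ract1.
- move=> /asboolP[a a1 ->] /asboolP[b b1 ->]; apply/asboolP.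
  by exists (a * b)%g; rewrite ?ractM// phiM a1 b1 mulg1.
Qed.
Canonical ker_equiv := EquivRelPack ker_rel_equiv.

Definition cover : smoothSpace R := quot_smooth ker_equiv.
Definition cpi : T -> cover := quot_pi ker_equiv.

Lemma cpiP x y : cpi x = cpi y <-> exists2 a, phi a = 1%g & y = act x a.
Proof.
split=> [/eqmodP/asboolP//|xy]; exact/(@eqmodP _ ker_equiv)/asboolP.
Qed.

Definition crepr (m : cover) : T :=
  generic_quotient.repr (m : {eq_quot ker_equiv}).

Lemma creprK m : cpi (crepr m) = m. Proof. exact: reprK. Qed.

Lemma cpi_continuous : continuous cpi.
Proof. exact: pi_continuous. Qed.

Lemma cpi_smooth x : smooth_map_at cpi x.
Proof. by split; [exact: cpi_continuous|move=> h; apply]. Qed.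

Lemma cover_continuous (Z : topologicalType) (f : cover -> Z) :
  continuous (f \o cpi) -> continuous f.
Proof.
by move=> cf; exact/(@quotient_continuous T {eq_quot ker_equiv} Z f).
Qed.

Lemma act_open (A : set T) a : open A -> open [set act x a | x in A].
Proof.
move=> oA; have -> : [set act x a | x in A] = act^~ a^-1%g @^-1` A.
  apply/seteqP; split=> [_ [x Ax <-]|x Ax]; first by rewrite /= ractK.
  by exists (act x a^-1%g) => //; rewrite ractKV.
by apply: open_comp => // x _; exact: cact.
Qed.

Lemma cpi_open (A : set T) : open A -> open (cpi @` A).
Proof.
move=> oA; rewrite /open /= /quotient_open.
have -> : cpi @^-1` (cpi @` A) =
    \bigcup_(a in [set a | phi a = 1%g]) [set act x a | x in A].
  apply/seteqP; split=> [y [x Ax /cpiP[a a1 ->]]|y [a a1 [x Ax <-]]].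
    by exists a => //; exists x.
  by exists x => //; apply/cpiP; exists a.
by apply: bigcup_open => a _; exact: act_open.
Qed.

Definition cact_rep (g : G) : N := sval (cid (phi_surj g)).

Lemma cact_repK g : phi (cact_rep g) = g.
Proof. by rewrite /cact_rep; case: cid. Qed.

Definition cover_act (m : cover) (g : G) : cover :=
  cpi (act (crepr m) (cact_rep g)).

(** The choice of a representative of [m] and of a preimage of [g] is
    immaterial. *)
Lemma cover_act_pi x a : cover_act (cpi x) (phi a) = cpi (act x a).
Proof.
have /cpiP[b b1 xb] := esym (creprK (cpi x)).
apply/cpiP; exists ((cact_rep (phi a))^-1 * b^-1 * a)%g.
  by rewrite !phiM !phiV cact_repK b1 invg1 mulg1 mulVg.
by rewrite -ractM !mulgA mulgV mul1g xb -ractM mulKVg.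
Qed.

Lemma cpi_surj m : exists x, m = cpi x.
Proof. by exists (crepr m); rewrite creprK. Qed.

Lemma cover_act1 m : cover_act m 1%g = m.
Proof. by have [x ->] := cpi_surj m; rewrite -phi1 cover_act_pi ract1. Qed.

Lemma cover_actM m g h : cover_act m (g * h)%g = cover_act (cover_act m g) h.
Proof.
have [x ->] := cpi_surj m; rewrite -(cact_repK g) -(cact_repK h) -phiM.
by rewrite !cover_act_pi ractM.
Qed.

Definition cover_raction : raction G cover := RAction cover_act1 cover_actM.

(** On a slice at [t] the covering map is injective because only the stabilizer
    of [t] returns points of the slice to it, and the kernel of [phi] meets that
    stabilizer trivially. *)
Lemma local_section t : exists (V : set T) (f : cover -> T),
  [/\ V t, diffeo_on (cpi @` V) V f, forall v, V v -> f (cpi v) = v,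
      forall v a, V v -> V (act v a) -> stabilizer act t a &
      forall v a, stabilizer act t a -> V v -> V (act v a)].
Proof.
have [V [[oV Vt] V1 V2]] := slice cact hT lcT pact t.
pose f (m : cover) : T := xget t [set v | V v /\ cpi v = m].
have fpi v : V v -> f (cpi v) = v.
  move=> Vv; rewrite /f; case: xgetP => [w _ [Vw /cpiP[a a1 va]]|/(_ v)[]//].
  have : stabilizer act t a by apply: (V1 w) => //; rewrite -va.
  by move=> /phi_free a1'; rewrite va a1'// ract1.
exists V, f; split=> //; split=> //; first exact: cpi_open.
exists cpi; split=> [_ [v Vv <-]|v Vv|_ [v Vv <-]|v Vv].
- by rewrite fpi.
- by exists v.
- rewrite fpi//; split=> //.
  have near_f x a : phi a = 1%g -> V (act x a) ->
      \forall y \near x, f (cpi y) = act y a.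
    move=> a1 Vx; have xV := open_nbhs_nbhs (conj oV Vx).
    apply: filterS (@nbhs_preimage _ _ (act^~ a) x V (@cact a x) xV) => y Vy.
    rewrite -[RHS]fpi//.
    by congr f; apply/cpiP; exists a.
  split=> [|h sh].
    move=> O; rewrite fpi// => Ov.
    have : nbhs v (O `&` V) by apply: filterI => //; exact: open_nbhs_nbhs.
    rewrite nbhsE => -[W [oW Wv] WV].
    apply: (@filterS _ _ _ (cpi @` W)); last first.
      by apply: open_nbhs_nbhs; split; [exact: cpi_open|exists v].
    by move=> _ [w /WV[Ow Vw] <-]; rewrite /= fpi.
  move=> x /esym/cpiP[a a1 xa]; rewrite fpi// in sh.
  have xa' : act x a^-1%g = v by rewrite xa ractK.
  have b1 : phi a^-1%g = 1%g by rewrite phiV a1 invg1.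
  have Vx : V (act x a^-1%g) by rewrite xa'.
  have [_ sm] := sact a^-1%g x.
  apply: smooth_at_local (sm h _); last by rewrite xa'.
  by apply: filterS (near_f x _ b1 Vx) => y /= ->.
- by rewrite fpi//; split=> //; exact: cpi_smooth.
Qed.

(** If [x] and [y] lie in distinct orbits of the kernel, then by
    [proper_separation] no element of the kernel moves a point near [x] to a
    point near [y]. *)
Lemma cover_hausdorff : hausdorff_space cover.
Proof.
rewrite open_hausdorff => m m'.
have [x ->] := cpi_surj m; have [y ->] := cpi_surj m' => xy.
have [A [B [[oA xA] [oB yB] AB]]] := proper_separation cact hT lcT pact x y.
exists (cpi @` A, cpi @` B); rewrite /= ?inE; split.
- by exists x.
- by exists y.
- exact: cpi_open.
- exact: cpi_open.
rewrite -subset0 => _ [[z Az <-] [w Bw /cpiP[a a1 zw]]].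
have a1' : phi a^-1%g = 1%g by rewrite phiV a1 invg1.
case/eqP: xy; apply/cpiP; exists a^-1%g => //.
by apply/esym/(AB z w) => //; rewrite zw ractK.
Qed.

Lemma cover_second_countable : @second_countable cover.
Proof.
have [_ [B cB [oB bB]] _] := mT.
exists [set cpi @` A | A in B].
  exact: card_le_trans (card_image_le _ _) cB.
split=> [_ [A BA <-]|m W].
  exact/cpi_open/oB.
have [x ->] := cpi_surj m => Wx.
have [A [BA Ax] AW] := bB x _ (cpi_continuous Wx).
exists (cpi @` A); first by split; [exists A|exists x].
by move=> _ [z Az <-]; exact: AW.
Qed.

Lemma cover_manifold : smooth_manifold cover.
Proof.
split; [exact: cover_hausdorff|exact: cover_second_countable|].
have [_ _ [d charts]] := mT; exists d => m; have [x ->] := cpi_surj m.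
have [V [f [Vx dV fpi _ _]]] := local_section x.
have [U [W [c [Ux dU]]]] := charts x.
have [Z dZ] := diffeo_comp dV dU.
exists (cpi @` V `&` f @^-1` U), Z, (c \o f); split=> //.
by split; [exists x|rewrite /= fpi].
Qed.

Lemma cover_smooth_action : smooth_action cover_raction.
Proof.
move=> g m; rewrite -(cact_repK g); set a := cact_rep g.
have E x : cover_act (cpi x) (phi a) = cpi (act x a) by exact: cover_act_pi.
split=> [|h sh]; last rewrite /smooth_at /= /quot_smooth_at => x xm.
  apply: (@cover_continuous _ (cover_act^~ (phi a))) => x.
  have -> : cover_act^~ (phi a) \o cpi = cpi \o act^~ a by apply/funext.
  by apply: continuous_comp; [exact: cact|exact: cpi_continuous].
have [_ sm] := sact a x.
apply: smooth_at_local (sm (h \o cpi) _).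
  by apply: nearW => y; rewrite /= E.
by move: sh; rewrite -xm /= E => /(_ _ erefl).
Qed.

Lemma cover_good : good_orbifold (Orbifold cover_raction).
Proof.
split; [exact: cover_manifold|exact: cover_smooth_action|].
by move=> K _; exact: finite_finset.
Qed.

Let O : orbifold R := Orbifold act.
Let P : orbifold R := Orbifold cover_raction.

Lemma orbit_piP (H : groupType) (X : topologicalType) (b : raction H X) x y :
  orbit_pi b x = orbit_pi b y <-> exists g, y = b x g.
Proof.
split=> [/eqmodP/asboolP//|xy]; exact/(@eqmodP _ (orbit_equiv b))/asboolP.
Qed.

Lemma orbit_pi_surj (H : groupType) (X : topologicalType) (b : raction H X) m :
  exists x, m = orbit_pi b x.
Proof.
exists (generic_quotient.repr (m : {eq_quot orbit_equiv b})).
by rewrite /orbit_pi reprK.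
Qed.

Lemma orbit_space_continuous (H : groupType) (X Z : topologicalType)
    (b : raction H X) (f : orbit_space b -> Z) :
  continuous (f \o orbit_pi b) -> continuous f.
Proof.
by move=> cf; exact/(@quotient_continuous X {eq_quot orbit_equiv b} Z f).
Qed.

Lemma orbit_pi_continuous (H : groupType) (X : topologicalType)
    (b : raction H X) : continuous (orbit_pi b).
Proof. exact: pi_continuous. Qed.

Definition orbit_map (m : underlying_space P) : underlying_space O :=
  orbit_pi act (crepr
    (generic_quotient.repr (m : {eq_quot orbit_equiv cover_raction}))).

Definition orbit_inv (m : underlying_space O) : underlying_space P :=
  orbit_pi cover_raction (cpi
    (generic_quotient.repr (m : {eq_quot orbit_equiv act}))).

Lemma orbit_map_pi x :
  orbit_map (orbit_pi cover_raction (cpi x)) = orbit_pi act x.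
Proof.
rewrite /orbit_map; set r := generic_quotient.repr _.
have : orbit_pi cover_raction r = orbit_pi cover_raction (cpi x).
  by rewrite /orbit_pi /r reprK.
move=> /orbit_piP[g]; rewrite -(creprK r) -(cact_repK g) [RHS]cover_act_pi.
move=> /esym/cpiP[a _ xa]; apply/orbit_piP.
by exists (cact_rep g * a)%g; rewrite ractM creprK.
Qed.

Lemma orbit_inv_pi x :
  orbit_inv (orbit_pi act x) = orbit_pi cover_raction (cpi x).
Proof.
rewrite /orbit_inv; set r := generic_quotient.repr _.
have : orbit_pi act r = orbit_pi act x by rewrite /orbit_pi /r reprK.
move=> /orbit_piP[a ->]; apply/orbit_piP; exists (phi a).
by rewrite -[RHS]/(cover_act _ _) cover_act_pi.
Qed.

(** The local lifts are the sections over slices.  Since the kernel of [phi]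
    acts freely, [phi] maps the stabilizer of [t] isomorphically onto the
    stabilizer of the image of [t]; the inverse isomorphism is [theta]. *)
Lemma orbit_map_diffeo : orbifold_diffeo orbit_map.
Proof.
split.
- apply: orbit_space_continuous; apply: cover_continuous.
  have -> : (orbit_map \o orbit_pi cover_raction) \o cpi = orbit_pi act.
    by apply/funext => x /=; rewrite orbit_map_pi.
  exact: orbit_pi_continuous.
- exists orbit_inv; split.
  + apply: orbit_space_continuous.
    have -> : orbit_inv \o orbit_pi act = orbit_pi cover_raction \o cpi.
      by apply/funext => x /=; rewrite orbit_inv_pi.
    move=> x; apply: continuous_comp; first exact: cpi_continuous.
    exact: orbit_pi_continuous.
  + move=> m; have [n ->] := orbit_pi_surj m; have [x ->] := cpi_surj n.
    by rewrite orbit_map_pi orbit_inv_pi.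
  + move=> m; have [x ->] := orbit_pi_surj m.
    by rewrite orbit_inv_pi orbit_map_pi.
move=> m; have [t ->] := cpi_surj m.
have [V [f [Vt dV fpi V1 V2]]] := local_section t.
pose theta (g : G) : N := xget 1%g [set a | stabilizer act t a /\ phi a = g].
have stab_uniq a b : stabilizer act t a -> stabilizer act t b ->
    phi a = phi b -> a = b.
  move=> ta tb ab; apply: (mulIg b^-1%g); rewrite mulgV.
  apply: (@phi_free _ t); first by rewrite phiM phiV ab mulgV.
  by rewrite ractM ta -[in LHS]tb ractK.
have thetaP g : stabilizer cover_raction (cpi t) g ->
    stabilizer act t (theta g) /\ phi (theta g) = g.
  rewrite /stabilizer /= -(cact_repK g).
  rewrite cover_act_pi => /cpiP[a a1 ta]; rewrite /theta.
  case: xgetP => [b _ //|/(_ (cact_rep g * a)%g)[]].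
  by rewrite /stabilizer /= ractM -ta phiM a1 mulg1.
have theta_phi a : stabilizer act t a -> theta (phi a) = a.
  move=> ta; rewrite /theta; case: xgetP => [b _ [tb]|/(_ a)[]//].
  exact: stab_uniq.
have stab_phi a : stabilizer act t a ->
    stabilizer cover_raction (cpi t) (phi a).
  rewrite /stabilizer /= => ta.
  by rewrite -[LHS]/(cover_act _ _) cover_act_pi ta.
exists (cpi @` V), V, f, theta; split.
  split=> [||_ [v Vv <-]]; [by exists t|by []|].
  by rewrite fpi// orbit_map_pi.
rewrite [f (cpi t)]fpi//; split.
- split.
  + by move=> g /thetaP[].
  + move=> g h /set_mem/thetaP[_ {2}<-] /set_mem/thetaP[_ {2}<-] E.
    by rewrite E.
  + by move=> a ta; exists (phi a); [exact: stab_phi|exact: theta_phi].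
- move=> g h /set_mem/thetaP[tg gK] /set_mem/thetaP[th hK].
  rewrite -{1}gK -{1}hK -phiM theta_phi//.
  by rewrite /stabilizer /= ractM tg.
- move=> _ g [v Vv <-] /thetaP[tg gK]; rewrite -{1 2}gK.
  rewrite -[orb_act _ _ _]/(cover_act (cpi v) (phi (theta g))) cover_act_pi.
  have Vg := V2 v _ tg Vv.
  by split; [exists (act v (theta g))|rewrite !fpi].
Qed.

Theorem very_good_quotient : very_good_orbifold O.
Proof.
split; first by split.
exists cover, G, cover_raction; split; first exact: cover_good.
by exists orbit_map; exact: orbit_map_diffeo.
Qed.

End VeryGoodQuotient.
(** * The Teichmueller space as an open cone of invariant forms *)

(** This provides both the coordinates on the space of invariant forms and a
    basis made of lattice vectors. *)
Lemma maximal_free_rows (F : fieldType) m (S : set 'rV[F]_m) :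
  exists d (B : 'M[F]_(d, m)), [/\ row_free B, forall i, S (row i B) &
    forall v, S v -> (v <= B)%MS].
Proof.
pose P d := `[< exists2 B : 'M[F]_(d, m), row_free B & forall i, S (row i B) >].
have P0 : exists d, P d.
  exists 0%N; apply/asboolP; exists 0; last by case.
  by rewrite /row_free mxrank0.
have Pm d : P d -> (d <= m)%N.
  by move=> /asboolP[B fB _]; rewrite -(eqP fB); exact: rank_leq_col.
case: (ex_maxnP P0 Pm) => d /asboolP[B fB SB] dmax.
exists d, B; split=> // v Sv.
apply: contraT => vB; suff /dmax : P (d + 1)%N by rewrite addn1 ltnn.
apply/asboolP; exists (col_mx B v) => [|i].
  have := @rank_ltmx _ _ _ _ B (B + v)%MS; rewrite (eqP fB) -row_leq_rank.
  rewrite -addsmxE addn1; apply; rewrite ltmxE addsmxSl addsmx_sub submx_refl.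
  exact: vB.
case: (split_ordP i) => j ->; first by rewrite rowKu.
by rewrite rowKd; have -> : row j v = v by apply/rowP => k; rewrite !ord1 mxE.
Qed.

Section RationalBalls.
Variables (R : realType) (m : nat).

(** The basis consists of the balls of radius [1 / (k + 1)] around rational
    points. *)
Lemma second_countable_rV : @second_countable 'rV[R]_m.
Proof.
pose B (qk : 'rV[rat]_m * nat) : set 'rV[R]_m :=
  ball (map_mx ratr qk.1 : 'rV[R]_m) (qk.2.+1%:R^-1).
exists (range B); first exact: card_le_trans (card_image_le _ _) (countableP _).
split=> [_ [qk _ <-]|x W /nbhs_ballP[e /= e0 eW]]; first exact: ball_open.
pose k := Num.truncn (2 / e).
have ke : k.+1%:R^-1 < e / 2.
  rewrite -[e / 2]invrK ltf_pV2 ?posrE ?ltr0n ?invr_gt0 ?divr_gt0//.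
  by rewrite invf_div; exact: truncnS_gt.
have k0 : 0 < k.+1%:R^-1 :> R by rewrite invr_gt0.
have qx j : exists q : rat, `|ratr q - x 0 j| < k.+1%:R^-1.
  have [|q] := @rat_in_itvoo R (x 0 j) (x 0 j + k.+1%:R^-1).
    by rewrite ltrDl.
  rewrite in_itv /= => /andP[xq qx]; exists q.
  by rewrite ger0_norm ?subr_ge0 ?ltW// ltrBlDl.
pose q : 'rV[rat]_m := \row_j sval (cid (qx j)).
have xB : ball (map_mx ratr q : 'rV[R]_m) k.+1%:R^-1 x.
  split=> // i j; rewrite ord1 !mxE /ball /=.
  by case: cid.
exists (B (q, k)); first by split=> //; exists (q, k).
move=> y yB; apply: eW.
apply: (@le_ball _ _ x (k.+1%:R^-1 + k.+1%:R^-1)).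
  by rewrite [leRHS]splitr lerD// ltW.
exact: ball_triangle (ball_sym xB) yB.
Qed.

End RationalBalls.

Lemma continuous_sub (X Y : topologicalType) (A : set Y)
    (f : X -> set_type A) x :
  {for x, continuous (fun z => \val (f z))} -> {for x, continuous f}.
Proof.
move=> cf O [_ [[W oW <-] /= Wx WO]].
have : nbhs x ((fun z => \val (f z)) @^-1` W).
  by apply: cf; exact: open_nbhs_nbhs.
by apply: filterS => z Wz; exact: WO.
Qed.

Section EuclidSmooth.
Variables (R : realType) (V : normedModType R) (m n : nat).

Lemma euclid_smooth_comp (p : V -> 'M[R]_(m, n)) (O : set V) x
    (h : 'M[R]_(m, n) -> R) :
  open_nbhs x O -> (forall k i j, Ck k O (fun y => p y i j)) ->
  euclid_smooth_at (p x) h -> euclid_smooth_at x (h \o p).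
Proof.
move=> [oO Ox] Cp [U [oU Upx] Ch].
have cp y : O y -> {for y, continuous p}.
  move=> Oy; apply: continuous_mx => i j.
  exact: Ck_continuous (Cp 0%N i j) Oy.
have oW : open (O `&` p @^-1` U) by exact: open_preimage_on.
exists (O `&` p @^-1` U) => [|k]; first by split.
apply: (Ck_comp oW oU _ (Ch k)) => [y []//|i j].
by apply: CkS (Cp k i j) => // y [].
Qed.

Lemma Ck_coord k (U : set 'M[R]_(m, n)) i j :
  Ck k U (fun X : 'M[R]_(m, n) => X i j).
Proof.
pose f (X : 'M[R]_(m, n)) : R := X i j.
have lin_f : linear_for *%R f by move=> a X Y; rewrite /f !mxE.
pose fL : {linear 'M[R]_(m, n) -> R} :=
  HB.pack f (GRing.isLinear.Build _ _ _ _ f lin_f).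
by apply: (@Ck_linear _ _ k U fL); exact: coord_continuous.
Qed.

End EuclidSmooth.

Section TflatSmooth.
Variables (R : realType) (n : nat) (Gamma : subgroup (Aff R n)).
Hypothesis GammaIso : Gamma `<=` @Iso R n.
Notation H := (holonomy Gamma).
Notation C := (Cflat_space Gamma).
Notation T := (Tflat Gamma).
Notation tpi := (quot_pi (Tflat_equiv Gamma)).

(** Flat metrics are recorded by their Gram matrices: the forms invariant under
    the holonomy group. *)
Definition inv_form (S : 'M[R]_n) : Prop :=
  S^T = S /\ forall h, H h -> (\val h)^T *m S *m \val h = S.

Lemma Cflat_gram (X : 'M[R]_n) : X \in unitmx ->
  Cflat Gamma X <-> inv_form (X^T *m X).
Proof.
move=> uX; split=> [[_ CX]|[_ IX]]; split=> //.
- by rewrite trmx_mul trmxK.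
- move=> h /CX; rewrite /Defs.orthogonal /= !trmx_mul -!mulmxA.
  move=> /(congr1 (fun Z => X^T *m Z *m X)); rewrite !mulmxA trmx_inv.
  by rewrite mulmxV ?unitmx_tr// mul1mx -!mulmxA mulVmx// mulmx1 mul1mx.
- move=> h /IX /= E; rewrite /Defs.orthogonal /= !trmx_mul trmx_inv !mulmxA.
  have -> : invmx X^T *m (\val h)^T *m X^T *m X *m \val h =
      invmx X^T *m ((\val h)^T *m (X^T *m X) *m \val h) by rewrite !mulmxA.
  by rewrite E mulmxA mulVmx ?unitmx_tr// mul1mx mulmxV.
Qed.

Lemma Cflat_unit (X : C) : \val X \in unitmx.
Proof. by have [] := set_mem (valP X). Qed.

Lemma Cflat_inv_form (X : C) : inv_form ((\val X)^T *m \val X).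
Proof. exact: (Cflat_gram (Cflat_unit X)).1 (set_mem (valP X)). Qed.

Lemma gram_orthogonal (X Y : 'M[R]_n) : X \in unitmx ->
  X^T *m X = Y^T *m Y -> exists2 Q, Defs.orthogonal Q & Y = Q *m X.
Proof.
move=> uX XY; exists (Y *m invmx X); last by rewrite mulmxKV.
rewrite /Defs.orthogonal /= trmx_mul trmx_inv -mulmxA (mulmxA Y^T) -XY.
by rewrite -!mulmxA mulmxV// mulmx1 mulVmx// unitmx_tr.
Qed.

(** Two matrices with the same Gram matrix differ by an orthogonal factor. *)
Lemma tpi_gram (X Y : C) :
  tpi X = tpi Y <-> (\val X)^T *m \val X = (\val Y)^T *m \val Y.
Proof.
rewrite quot_pi_Tflat; split=> [[Q OQ ->]|].
  by rewrite trmx_mul -mulmxA (mulmxA Q^T) OQ mul1mx.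
exact/gram_orthogonal/Cflat_unit.
Qed.

Lemma tpi_continuous : continuous tpi.
Proof. exact: pi_continuous. Qed.

Lemma Tflat_continuous (Z : topologicalType) (f : T -> Z) :
  continuous (f \o tpi) -> continuous f.
Proof.
by move=> cf; exact/(@quotient_continuous C {eq_quot Tflat_equiv Gamma} Z f).
Qed.

Lemma val_continuous : continuous (fun X : C => \val X : 'M[R]_n).
Proof. exact: initial_continuous. Qed.

Lemma Cflat_act_continuous A : continuous (@Cflat_act R n Gamma ^~ A).
Proof.
move=> X; apply: continuous_sub => /=.
apply: (@continuous_comp _ _ _ (fun X : C => \val X : 'M[R]_n)
  (fun Z : 'M[R]_n => Z *m \val (\val A))); first exact: val_continuous.
apply: continuous_mx => i j.
have -> : (fun Z : 'M[R]_n => (Z *m \val (\val A)) i j) =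
    (fun Z => \sum_k Z i k * \val (\val A) k j).
  by apply/funext => Z; rewrite mxE.
apply: continuous_sum => k Z; exact: (cvgMl (@coord_continuous R n n i k Z)).
Qed.

Lemma Tflat_smooth_action : smooth_action (Tflat_raction Gamma).
Proof.
move=> A t; split=> [|f sf].
  apply: (@Tflat_continuous _ (fun t => Tflat_act t A)).
  have -> : (fun t => Tflat_act t A) \o tpi =
      tpi \o (@Cflat_act R n Gamma ^~ A).
    by apply/funext => X /=; rewrite Tflat_act_pi.
  move=> X; apply: continuous_comp; first exact: Cflat_act_continuous.
  exact: tpi_continuous.
rewrite /smooth_at /= /quot_smooth_at => X Xt.
have [|g sg fg] := sf (Cflat_act X A); first by rewrite -Tflat_act_pi Xt.
exists (g \o (fun Z => Z *m \val (\val A))).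
  apply: (@euclid_smooth_comp _ _ _ _
    (fun Z : 'M[R]_n => Z *m \val (\val A)) setT) => //.
    by split; [exact: openT|].
  move=> k i j.
  have := @Ck_sum _ _ k setT _ (index_enum 'I_n)
    (fun l (Z : 'M[R]_n) => Z i l * \val (\val A) l j) openT.
  move=> /(_ (fun l => CkM openT (Ck_coord k setT i l) (Ck_cst k setT _))).
  by apply: Ck_eq => [|Z _]; [exact: openT|rewrite mxE].
have := @nbhs_preimage _ _ (@Cflat_act R n Gamma ^~ A) X _
  (@Cflat_act_continuous A X) fg.
by apply: filterS => Y /=; rewrite Tflat_act_pi.
Qed.

Section Chart.
Variables (d : nat) (B : 'M[R]_(d, n * n)).
Hypothesis freeB : row_free B.

Definition form (y : 'rV[R]_d) : 'M[R]_n := vec_mx (y *m B).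

Hypothesis formI : forall y, inv_form (form y).
Hypothesis formS : forall S, inv_form S -> (mxvec S <= B)%MS.

Definition form_coord (S : 'M[R]_n) : 'rV[R]_d := mxvec S *m pinvmx B.

Lemma form_coordK S : inv_form S -> form (form_coord S) = S.
Proof. by move=> IS; rewrite /form mulmxKpV ?mxvecK//; exact: formS. Qed.

Lemma formK : cancel form form_coord.
Proof. by move=> y; rewrite /form_coord /form vec_mxK mulmxKp. Qed.

Lemma Ck_form k (U : set 'rV[R]_d) i j : open U -> Ck k U (fun y => form y i j).
Proof.
move=> oU; have := @Ck_sum _ _ k U _ (index_enum 'I_d)
  (fun l (y : 'rV[R]_d) => y 0 l * B l (mxvec_index i j)) oU.
move=> /(_ (fun l => CkM oU (Ck_coord k U 0 l) (Ck_cst k U _))).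
by apply: Ck_eq => // y _; rewrite !mxE.
Qed.

Definition gram_coord (X : 'M[R]_n) : 'rV[R]_d := form_coord (X^T *m X).

Lemma Ck_gram_coord k i j : Ck k setT (fun X => gram_coord X i j).
Proof.
have oT : open [set: 'M[R]_n] by exact: openT.
have CG l : Ck k setT (fun X : 'M[R]_n => mxvec (X^T *m X) 0 l).
  case/mxvec_indexP: l => a b.
  have := @Ck_sum _ _ k setT _ (index_enum 'I_n)
    (fun l (X : 'M[R]_n) => X l a * X l b) oT.
  move=> /(_ (fun l => CkM oT (Ck_coord k setT l a) (Ck_coord k setT l b))).
  apply: Ck_eq => // X _; rewrite mxvecE mxE.
  by apply: eq_bigr => l _; rewrite mxE.
have := @Ck_sum _ _ k setT _ (index_enum 'I_(n * n))
  (fun l (X : 'M[R]_n) => mxvec (X^T *m X) 0 l * pinvmx B l j) oT.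
move=> /(_ (fun l => CkM oT (CG l) (Ck_cst k setT _))).
by apply: Ck_eq => // X _; rewrite !ord1 [RHS]mxE.
Qed.

Definition pos_forms : set 'rV[R]_d := [set y | posdef (form y)].

Lemma pos_forms_open : open pos_forms.
Proof.
rewrite openE => y py; rewrite /interior.
have cf : {for y, continuous form}.
  apply: continuous_mx => i j.
  by apply: (@Ck_continuous _ _ 0 setT) => //; apply: Ck_form; exact: openT.
have := @nbhs_preimage _ _ form y _ cf (posdef_near py).
by apply: filterS => z /= pz; split=> //; have [] := formI z.
Qed.

Definition chart (t : T) : 'rV[R]_d := gram_coord (\val (Tflat_repr t)).

Lemma chart_pi X : chart (tpi X) = gram_coord (\val X).
Proof.
rewrite /chart /gram_coord; congr form_coord; apply/tpi_gram.
exact: Tflat_reprK.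
Qed.

Lemma one_in_Cflat : 1%:M \in Cflat Gamma.
Proof.
apply/mem_set; split; first exact: unitmx1.
by move=> _ [g /GammaIso Ig <-]; rewrite mul1mx invmx1 mulmx1.
Qed.

(** A global section of the projection to the Teichmueller space; the identity
    is the default value outside the cone. *)
Definition lift (y : 'rV[R]_d) : C :=
  insubd (exist (fun X => X \in Cflat Gamma) _ one_in_Cflat :
    set_type (Cflat Gamma))
    (chol (form y)).

Lemma val_lift y : pos_forms y -> \val (lift y) = chol (form y).
Proof.
move=> py; rewrite /lift val_insubd.
suff -> : chol (form y) \in Cflat Gamma by [].
apply/mem_set/Cflat_gram; first exact: chol_unit.
by rewrite chol_gram//; exact: formI.
Qed.

Lemma Ck_chol_form k i j : Ck k pos_forms (fun y => chol (form y) i j).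
Proof.
apply: Ck_chol => [|y//|a b]; first exact: pos_forms_open.
exact: Ck_form pos_forms_open.
Qed.

Lemma lift_continuous y : pos_forms y -> {for y, continuous lift}.
Proof.
move=> py; apply: continuous_sub.
have cc : {for y, continuous (fun z => chol (form z))}.
  by apply: continuous_mx => i j; exact: Ck_continuous (Ck_chol_form 0 i j) py.
rewrite /prop_for /continuous_at val_lift//.
move=> W /(nbhs_preimage cc); have := open_nbhs_nbhs (conj pos_forms_open py).
by apply: filterS2 => z pz; rewrite /= val_lift.
Qed.

Lemma chart_lift y : pos_forms y -> chart (tpi (lift y)) = y.
Proof.
move=> py; rewrite chart_pi val_lift// /gram_coord chol_gram//; exact: formK.
Qed.

Lemma form_chart X : form (chart (tpi X)) = (\val X)^T *m \val X.
Proof. by rewrite chart_pi form_coordK//; exact: Cflat_inv_form. Qed.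

Lemma chart_pos t : pos_forms (chart t).
Proof.
have [X ->] := quot_pi_Tflat_surj t; rewrite /pos_forms /= form_chart.
exact/posdef_gram/Cflat_unit.
Qed.

Lemma lift_chart t : tpi (lift (chart t)) = t.
Proof.
have [X ->] := quot_pi_Tflat_surj t; apply/tpi_gram.
rewrite val_lift; last exact: chart_pos.
by rewrite chol_gram; [exact: form_chart|exact: chart_pos].
Qed.

Lemma chart_continuous : continuous chart.
Proof.
apply: Tflat_continuous.
have -> : chart \o tpi = gram_coord \o (fun X : C => \val X).
  by apply/funext => X /=; rewrite chart_pi.
move=> X; apply: (@continuous_comp _ _ _
  (fun X : C => \val X : 'M[R]_n) gram_coord).
  exact: val_continuous.
by apply: continuous_mx => i j; exact: Ck_continuous (Ck_gram_coord 0 i j) I.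
Qed.

Lemma chart_smooth t : @smooth_map_at _ T (euclid 'rV[R]_d) chart t.
Proof.
split; first exact: chart_continuous.
move=> h sh; rewrite /smooth_at /= /quot_smooth_at => X Xt.
exists (h \o gram_coord).
  apply: (@euclid_smooth_comp _ _ _ _ gram_coord setT).
  - by split; [exact: openT|].
  - by move=> k i j; exact: Ck_gram_coord.
  - by rewrite -chart_pi Xt.
by apply: (@filterE _ (nbhs X)) => Y /=; rewrite chart_pi.
Qed.

Lemma lift_smooth y : pos_forms y ->
  @smooth_map_at _ (euclid 'rV[R]_d) T (tpi \o lift) y.
Proof.
move=> py; have cl := lift_continuous py; split.
  by apply: continuous_comp cl _; exact: tpi_continuous.
move=> f sf; have [//|g sg fg] := sf (lift y).
apply: (@smooth_at_local _ (euclid 'rV[R]_d) y (g \o (fun z => chol (form z)))).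
  have yP := open_nbhs_nbhs (conj pos_forms_open py).
  have yf := @nbhs_preimage _ _ lift y _ cl fg.
  have near_y : nbhs (y : 'rV[R]_d)
      [set z | g (chol (form z)) = f (tpi (lift z))].
    by move: yP yf; apply: filterS2 => z pz /= ->; rewrite val_lift.
  exact: near_y.
apply: (@euclid_smooth_comp _ _ _ _ (fun z => chol (form z)) pos_forms).
- by split=> //; exact: pos_forms_open.
- by move=> k i j; exact: Ck_chol_form.
- by rewrite -val_lift.
Qed.

Lemma chart_diffeo : @diffeo_on _ T (euclid 'rV[R]_d) setT pos_forms chart.
Proof.
split; [exact: openT|exact: pos_forms_open|].
exists (tpi \o lift); split=> [t _|y _|t _|y py].
- exact: chart_pos.
- exact: I.
- by split; [exact: lift_chart|exact: chart_smooth].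
- by split; [exact: chart_lift|exact: lift_smooth].
Qed.

Lemma chart_hausdorff : hausdorff_space T.
Proof.
rewrite open_hausdorff => t u tu.
have : chart t != chart u.
  by apply: contra tu => /eqP E; rewrite -(lift_chart t) E lift_chart.
have := @norm_hausdorff R 'rV[R]_d; rewrite open_hausdorff => /[apply].
move=> [[A1 A2] /= [/set_mem tA /set_mem uA] [oA1 oA2 A12]].
exists (chart @^-1` A1, chart @^-1` A2) => /=; first by split; exact: mem_set.
have oc A : open A -> open (chart @^-1` A).
  by move=> oA; apply: open_comp => // z _; exact: chart_continuous.
split; [exact: oc|exact: oc|].
apply/eqP; rewrite -subset0 => z [z1 z2].
by move/eqP: A12; rewrite -subset0 => /(_ (chart z)); apply.
Qed.

Lemma chart_second_countable : @second_countable T.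
Proof.
have [D cD [oD bD]] := @second_countable_rV R d.
exists [set chart @^-1` A | A in D].
  exact: card_le_trans (card_image_le _ _) cD.
split=> [_ [A DA <-]|t W Wt].
  by apply: open_comp; [move=> z _; exact: chart_continuous|exact: oD].
have [cl _] := lift_smooth (chart_pos t).
have : nbhs (chart t) ((tpi \o lift) @^-1` W).
  by apply: nbhs_preimage cl _; rewrite /= lift_chart.
move=> /bD[A [DA At] AW]; exists (chart @^-1` A); first by split=> //; exists A.
by move=> u /AW; rewrite /= lift_chart.
Qed.

End Chart.

Lemma inv_form_lin a (S S' : 'M[R]_n) :
  inv_form S -> inv_form S' -> inv_form (a *: S + S').
Proof.
move=> [sS iS] [sS' iS']; split; first by rewrite linearP /= sS sS'.
move=> h Hh; rewrite mulmxDr mulmxDl -scalemxAr -scalemxAl iS// iS'//.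
Qed.

Lemma Tflat_manifold : smooth_manifold T.
Proof.
have [d [B [fB SB BS]]] := maximal_free_rows [set v | inv_form (vec_mx v)].
have formI y : inv_form (form B y).
  rewrite /form mulmx_sum_row linear_sum /=.
  elim/big_rec: _ => [|i S _ IS].
    by split=> [|h _]; rewrite ?trmx0// mulmx0 mul0mx.
  by rewrite linearZ; apply: inv_form_lin => //; exact: SB.
have formS S : inv_form S -> (mxvec S <= B)%MS.
  by move=> IS; apply: BS; rewrite /= mxvecK.
split.
- exact: (chart_hausdorff formI formS).
- exact: (chart_second_countable formI formS).
exists d => t; exists setT, (pos_forms B), (chart B).
by split; [|exact: (chart_diffeo fB formI formS)].
Qed.

End TflatSmooth.
(** * Euclidean geometry of vectors and matrices *)

Section Euclid.
Variables (R : realType) (n : nat).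
Implicit Types (u v w : 'cV[R]_n) (A B M : 'M[R]_n).

Definition dot u v : R := (u^T *m v) 0 0.
Definition enorm u : R := Num.sqrt (dot u u).

Lemma dotE u v : dot u v = \sum_i u i 0 * v i 0.
Proof. by rewrite /dot mxE; apply: eq_bigr => i _; rewrite mxE. Qed.

Lemma dotC u v : dot u v = dot v u.
Proof. by rewrite !dotE; apply: eq_bigr => i _; rewrite mulrC. Qed.

Lemma dotDl u v w : dot (u + v) w = dot u w + dot v w.
Proof. by rewrite /dot linearD mulmxDl mxE. Qed.

Lemma dotZl a u v : dot (a *: u) v = a * dot u v.
Proof. by rewrite /dot linearZ /= -scalemxAl mxE. Qed.

Lemma dotDr u v w : dot u (v + w) = dot u v + dot u w.
Proof. by rewrite dotC dotDl !(dotC u). Qed.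

Lemma dotZr a u v : dot u (a *: v) = a * dot u v.
Proof. by rewrite dotC dotZl dotC. Qed.

Lemma dotNr u v : dot u (- v) = - dot u v.
Proof. by rewrite -scaleN1r dotZr mulN1r. Qed.

Lemma dotNl u v : dot (- u) v = - dot u v.
Proof. by rewrite dotC dotNr dotC. Qed.

Lemma dot_mulmx A u v : dot (A *m u) v = dot u (A^T *m v).
Proof. by rewrite /dot trmx_mul mulmxA. Qed.

Lemma dot_ge0 u : 0 <= dot u u.
Proof. by rewrite dotE sumr_ge0// => i _; rewrite -expr2 sqr_ge0. Qed.

Lemma sqr_enorm u : enorm u ^+ 2 = dot u u.
Proof. by rewrite sqr_sqrtr// dot_ge0. Qed.

Lemma enorm_ge0 u : 0 <= enorm u. Proof. exact: sqrtr_ge0. Qed.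

Lemma enorm_entry u i : `|u i 0| <= enorm u.
Proof.
rewrite -(@ler_pXn2r _ 2%N)// ?nnegrE// ?enorm_ge0//.
rewrite sqr_enorm real_normK ?num_real//.
rewrite dotE (bigD1 i)//= expr2 lerDl sumr_ge0// => j _.
by rewrite -expr2 sqr_ge0.
Qed.

Lemma enorm_eq0 u : enorm u = 0 -> u = 0.
Proof.
move=> u0; apply/colP => i; rewrite mxE; apply/eqP.
by rewrite -normr_le0 -u0 enorm_entry.
Qed.

Lemma enorm0 : enorm 0 = 0.
Proof. by rewrite /enorm /dot mulmx0 mxE sqrtr0. Qed.

Lemma enorm_gt0 u : u != 0 -> 0 < enorm u.
Proof.
move=> u0; rewrite lt_neqAle enorm_ge0 andbT.
by apply: contra u0 => /eqP/esym/enorm_eq0 ->.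
Qed.

Lemma enormZ a u : enorm (a *: u) = `|a| * enorm u.
Proof.
by rewrite /enorm dotZl dotZr mulrA -expr2 sqrtrM ?sqr_ge0// sqrtr_sqr.
Qed.

Lemma enormN u : enorm (- u) = enorm u.
Proof. by rewrite -scaleN1r enormZ normrN1 mul1r. Qed.

Lemma dot_le u v : dot u v <= enorm u * enorm v.
Proof.
have [->|u0] := eqVneq u 0; first by rewrite enorm0 mul0r /dot trmx0 mul0mx mxE.
have a0 := enorm_gt0 u0; have b0 := enorm_ge0 v.
have := dot_ge0 (enorm v *: u + - enorm u *: v).
rewrite !dotDl !dotDr !dotZl !dotZr -!sqr_enorm (dotC v u).
have [->|v0] := eqVneq v 0.
  by rewrite enorm0 mulr0 /dot mulmx0 mxE.
have {}b0 := enorm_gt0 v0.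
move: (enorm u) (enorm v) (dot u v) a0 b0 => a b c a0 b0.
have ab : 0 < a * b by exact: mulr_gt0.
move=> H; rewrite -(ler_pM2l ab); nra.
Qed.

Lemma enormD u v : enorm (u + v) <= enorm u + enorm v.
Proof.
rewrite -(@ler_pXn2r _ 2%N)// ?nnegrE ?addr_ge0 ?enorm_ge0//.
rewrite sqr_enorm dotDl !dotDr (dotC v u) -!sqr_enorm.
by have := dot_le u v; nra.
Qed.

Lemma enormB u v : enorm (u - v) <= enorm u + enorm v.
Proof. by rewrite -(enormN v) enormD. Qed.

Lemma enorm_subr u v : enorm u - enorm v <= enorm (u - v).
Proof. by rewrite lerBlDr -{1}(subrK v u) enormD. Qed.

Lemma enorm_addr u v : enorm u - enorm v <= enorm (u + v).
Proof. by rewrite -[v]opprK enormN enorm_subr. Qed.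

Lemma orthogonal_dot A u v :
  Defs.orthogonal A -> dot (A *m u) (A *m v) = dot u v.
Proof. by move=> OA; rewrite /dot trmx_mul -mulmxA (mulmxA A^T) OA mul1mx. Qed.

Lemma enorm_orth A u : Defs.orthogonal A -> enorm (A *m u) = enorm u.
Proof. by move=> OA; rewrite /enorm orthogonal_dot. Qed.

Lemma mx_entry_le p q (M : 'M[R]_(p, q)) i j : `|M i j| <= `|M|.
Proof.
by rewrite [leRHS]/Num.Def.normr/= mx_normrE; exact: (le_bigmax _ _ (i, j)).
Qed.

Lemma mx_norm_le p q (M : 'M[R]_(p, q)) c : 0 <= c ->
  (forall i j, `|M i j| <= c) -> `|M| <= c.
Proof.
move=> c0 H; rewrite [leLHS]/Num.Def.normr/= mx_normrE.
by apply/bigmax_leP; split=> // -[i j] _; exact: H.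
Qed.

Lemma mx_norm_mul p q r (M : 'M[R]_(p, q)) (M' : 'M[R]_(q, r)) :
  `|M *m M'| <= q%:R * `|M| * `|M'|.
Proof.
apply: mx_norm_le => [|i j]; first by rewrite !mulr_ge0.
rewrite mxE; apply: le_trans (ler_norm_sum _ _ _) _.
have -> : q%:R * `|M| * `|M'| = \sum_(k < q) `|M| * `|M'|.
  by rewrite sumr_const card_ord -mulrA mulr_natl.
by apply: ler_sum => k _; rewrite normrM ler_pM ?mx_entry_le.
Qed.

Lemma mx_norm_tr p q (M : 'M[R]_(p, q)) : `|M^T| = `|M|.
Proof.
apply/eqP; rewrite eq_le; apply/andP; split; apply: mx_norm_le => // i j.
  by rewrite mxE mx_entry_le.
by have := mx_entry_le M^T j i; rewrite mxE.
Qed.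

Lemma mx_norm_enorm u : `|u| <= enorm u.
Proof.
by apply: mx_norm_le => [|i j]; rewrite ?enorm_ge0// !ord1 enorm_entry.
Qed.

Lemma enorm_mx_norm u : enorm u <= n%:R * `|u|.
Proof.
have [n0|n0] := posnP n.
  rewrite /enorm dotE big1 ?sqrtr0 ?mulr_ge0// => i _.
  by have := ltn_ord i; rewrite [X in (_ < X)%N]n0.
rewrite -(@ler_pXn2r _ 2%N)// ?nnegrE ?enorm_ge0 ?mulr_ge0// sqr_enorm dotE.
apply: (@le_trans _ _ (\sum_(i < n) `|u| ^+ 2)).
  apply: ler_sum => i _; rewrite -expr2 -real_normK ?num_real//.
  by rewrite ler_pXn2r ?nnegrE ?mx_entry_le.
rewrite sumr_const card_ord -[leLHS]mulr_natl exprMn ler_wpM2r ?sqr_ge0//.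
by rewrite expr2 ler_peMl ?ler0n// ler1n.
Qed.

Lemma enorm_mulmx M u : enorm (M *m u) <= (n%:R ^+ 2 * `|M|) * enorm u.
Proof.
apply: le_trans (enorm_mx_norm _) _; rewrite expr2 -!mulrA.
apply: ler_wpM2l => //.
apply: le_trans (mx_norm_mul _ _) _; rewrite -!mulrA; apply: ler_wpM2l => //.
by apply: ler_wpM2l => //; exact: mx_norm_enorm.
Qed.

Lemma orthogonal_norm A : Defs.orthogonal A -> `|A| <= 1.
Proof.
move=> OA; apply: mx_norm_le => // i j.
have -> : A i j = (A *m (delta_mx j 0 : 'cV_n)) i 0 by rewrite -colE mxE.
apply: le_trans (enorm_entry _ _) _; rewrite enorm_orth//.
by rewrite /enorm /dot trmx_delta mul_delta_mx !mxE !eqxx sqrtr1.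
Qed.

Lemma orthogonal_tr A : Defs.orthogonal A -> A *m A^T = 1%:M.
Proof. exact: mulmx1C. Qed.

Lemma orthogonalT A : Defs.orthogonal A -> Defs.orthogonal A^T.
Proof. by move=> OA; rewrite /Defs.orthogonal /= trmxK orthogonal_tr. Qed.

Lemma orthogonal_inv A : Defs.orthogonal A -> invmx A = A^T.
Proof.
move=> OA; have uA : A \in unitmx by case/mulmx1_unit: OA.
by rewrite -[RHS](mulmxK uA) OA mul1mx.
Qed.

Lemma orthogonalM A B : Defs.orthogonal A -> Defs.orthogonal B ->
  Defs.orthogonal (A *m B).
Proof.
move=> OA OB.
by rewrite /Defs.orthogonal /= trmx_mul -mulmxA (mulmxA A^T) OA mul1mx.
Qed.

Definition disp A u := A *m u - u.

Lemma dispD A u v : disp A (u + v) = disp A u + disp A v.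
Proof. by rewrite /disp mulmxDr opprD addrACA. Qed.

Lemma dispZ A a u : disp A (a *: u) = a *: disp A u.
Proof. by rewrite /disp -scalemxAr scalerBr. Qed.

Definition small A (mu : R) : Prop :=
  forall u, enorm (disp A u) <= mu * enorm u.

Lemma small_le A mu nu : mu <= nu -> small A mu -> small A nu.
Proof.
move=> mn sA u; apply: le_trans (sA u) _.
by apply: ler_wpM2r => //; exact: enorm_ge0.
Qed.

(** Normality of an orthogonal matrix makes the displacement log-convex along
    its own iterates. *)
Lemma disp_convex A u : Defs.orthogonal A ->
  enorm (disp A u) ^+ 2 <= enorm u * enorm (disp A (disp A u)).
Proof.
move=> OA; rewrite sqr_enorm.
have E (z : 'cV[R]_n) : A^T *m (A *m z - z) = z - A^T *m z.
  by rewrite mulmxBr mulmxA OA mul1mx.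
have -> : dot (disp A u) (disp A u) = dot (- u) (A^T *m disp A (disp A u)).
  set w := disp A u; rewrite {1}/w /disp dotDl dotNl dot_mulmx -dotNr -dotDr.
  by rewrite dotNl -dotNr (E w) [in RHS]opprB.
apply: le_trans (dot_le _ _) _.
by rewrite enormN enorm_orth//; exact: orthogonalT.
Qed.

End Euclid.

(** * Discrete subgroups *)

(** Grid argument: distinct points of the set fall in distinct cells of side
    [eps], and finitely many cells meet a bounded region. *)
Lemma separated_finite (R : realType) (T : Type) m n (S : set T)
    (f : T -> 'M[R]_(m, n)) (C eps : R) :
  0 < eps -> (forall x, S x -> `|f x| <= C) ->
  (forall x y, S x -> S y -> `|f x - f y| <= eps -> x = y) -> finite_set S.
Proof.
move=> eps0 fC sep.
pose K := Num.truncn (2 * C / eps).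
pose cell (x : T) : 'M['I_K.+1]_(m, n) :=
  \matrix_(i, j) inord (Num.truncn ((f x i j + C) / eps)).
have cellE x i j : S x -> exists2 k : nat, cell x i j = k :> nat &
    k%:R <= (f x i j + C) / eps < k.+1%:R.
  move=> Sx; have := fC x Sx; have := mx_entry_le (f x) i j => fij fCx.
  have := le_trans fij fCx; rewrite ler_norml => /andP[lo hi].
  have p0 : 0 <= (f x i j + C) / eps by apply: divr_ge0; [lra|exact: ltW].
  exists (Num.truncn ((f x i j + C) / eps)); last exact: truncn_itv.
  rewrite mxE inordK// ltnS; apply: le_truncn; apply: ler_wpM2r.
    by rewrite invr_ge0 ltW.
  by rewrite mulr_natl mulr2n lerD2r.
have inj : {in S &, injective cell}.
  move=> x y /set_mem Sx /set_mem Sy xy; apply: sep => //.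
  apply: mx_norm_le => [|i j]; first exact: ltW.
  have [k xk /andP[k1 k2]] := cellE x i j Sx.
  have [l yl /andP[l1 l2]] := cellE y i j Sy.
  have kl : k = l by rewrite -xk -yl xy.
  rewrite -kl in l1 l2; rewrite !mxE.
  move: k1 k2 l1 l2.
  rewrite !ler_pdivlMr// !ltr_pdivrMr// -natr1 => k1 k2 l1 l2.
  by rewrite ler_norml; apply/andP; split; lra.
rewrite -(eq_finite_set (inj_card_eq inj)); exact: finite_finset.
Qed.

(** * The first Bieberbach theorem *)

Lemma finite_min (R : realType) (T : choiceType) (S : set T) (f : T -> R) :
  finite_set S -> S !=set0 -> exists2 x, S x & forall y, S y -> f x <= f y.
Proof.
move=> /finite_seqP[s ->] [x0 /=]; elim: s x0 => // a s IH x0 _.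
have [->|/hasP[b bs _]] : s = [::] \/ has predT s.
  by case: s {IH} => [|b s]; [left|right].
  by exists a => [|y]; rewrite /= ?mem_head// inE => /eqP->.
have [x xs xmin] := IH b bs.
have [ax|xa] := leP (f a) (f x).
  exists a => [|y]; rewrite /= ?mem_head// inE => /orP[/eqP->//|/xmin].
  exact: le_trans.
exists x => [|y]; rewrite /= inE ?xs ?orbT// => /orP[/eqP->|/xmin//].
exact: ltW.
Qed.

Section AffGroup.
Variables (R : realType) (n : nat).
Implicit Types g h : Aff R n.

Definition rot g : 'M[R]_n := \val g.1.

Lemma rot_unit g : rot g \in unitmx. Proof. exact: Defs.GL_unit. Qed.

Lemma rotM g h : rot (g * h)%g = rot g *m rot h. Proof. by []. Qed.
Lemma rotV g : rot g^-1%g = invmx (rot g). Proof. by []. Qed.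

Lemma trnM g h : (g * h)%g.2 = rot g *m h.2 + g.2. Proof. by []. Qed.

Lemma trnV g : (g^-1)%g.2 = - (invmx (rot g) *m g.2). Proof. by []. Qed.

Lemma trn_div g h : (g / h)%g.2 = g.2 - rot (g / h)%g *m h.2.
Proof.
by rewrite trnM rotM rotV trnV mulmxN mulmxA addrC.
Qed.

Lemma Aff_eq g h : rot g = rot h -> g.2 = h.2 -> g = h.
Proof. by case: g h => [A a] [B b] /= AB ->; congr pair; exact: val_inj. Qed.

End AffGroup.

Section Bieberbach.
Variables (R : realType) (n : nat) (Gamma : subgroup (Aff R n)).
Hypothesis cryst : crystallographic Gamma.
Notation G := (subgroup_set Gamma).

Lemma rot_orth g : G g -> Defs.orthogonal (rot g).
Proof. by move=> Gg; have [I _ _] := cryst; exact: I. Qed.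

Lemma discrete_at_one : exists2 eps : R, 0 < eps &
  forall g, G g -> `|rot g - 1%:M| < eps -> `|g.2| < eps -> g = 1%g.
Proof.
have [_ /(_ 1%g (subgroup1 _)) disc _] := cryst.
case: disc => -[P Q] /= [P1 Q1] PQ.
case: P1 => _ [[W oW <-] /= W1 WP].
have /nbhs_ballP[e1 /= e10 b1] : nbhs (1%:M : 'M[R]_n) W.
  exact: open_nbhs_nbhs.
have /nbhs_ballP[e2 /= e20 b2] := Q1.
exists (Num.min e1 e2) => [|g Gg g1 g2]; first by rewrite lt_min e10.
apply: PQ => //; split; last first.
  apply: b2; rewrite -ball_normE /= sub0r normrN (lt_le_trans g2)//.
  by rewrite ge_min lexx orbT.
apply: WP; apply: b1; rewrite -ball_normE /= distrC (lt_le_trans g1)//.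
by rewrite ge_min lexx.
Qed.

(** Rotations are bounded, so that elements with bounded translation part lie in
    a bounded region; they are separated there, because [g h^-1] is close to the
    identity when [g] and [h] are close. *)
Lemma finite_bounded (r : R) : finite_set [set g | G g /\ enorm g.2 <= r].
Proof.
have [eps eps0 disc] := discrete_at_one.
pose c : R := 2 + n%:R + n%:R * n%:R * `|r|.
have c0 : 0 < c by rewrite /c -addrA ltr_pwDl// addr_ge0// !mulr_ge0.
pose f (g : Aff R n) : 'M[R]_(n, n + 1) := row_mx (rot g) g.2.
apply: (@separated_finite _ _ _ _ _ f (1 + `|r|) (eps / c)).
- exact: divr_gt0.
- move=> g [Gg gr]; apply: mx_norm_le => [|i j]; first exact: addr_ge0.
  rewrite /f mxE; case: splitP => k _.
    apply: le_trans (mx_entry_le _ _ _) _.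
    by apply: le_trans (orthogonal_norm (rot_orth Gg)) _; rewrite lerDl.
  apply: le_trans (mx_entry_le _ _ _) _; apply: le_trans (mx_norm_enorm _) _.
  by apply: (le_trans gr); apply: le_trans (ler_norm r) _; rewrite lerDr.
move=> g h [Gg gr] [Gh hr] gh; have Og := rot_orth Gg; have Oh := rot_orth Gh.
have fE : f g - f h = row_mx (rot g - rot h) (g.2 - h.2).
  by rewrite /f opp_row_mx add_row_mx.
have close1 : `|rot g - rot h| <= eps / c.
  apply: mx_norm_le => [|i j]; first by rewrite divr_ge0 ?ltW.
  apply: le_trans gh; rewrite fE.
  apply: le_trans (mx_entry_le _ i (lshift 1 j)).
  by rewrite row_mxEl.
have close2 : `|g.2 - h.2| <= eps / c.
  apply: mx_norm_le => [|i j]; first by rewrite divr_ge0 ?ltW.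
  apply: le_trans gh; rewrite fE.
  apply: le_trans (mx_entry_le _ i (rshift n j)).
  by rewrite row_mxEr.
have ec : eps = c * (eps / c) by rewrite mulrC divfK// gt_eqF.
set e := eps / c in close1 close2 ec; have e0 : 0 < e by exact: divr_gt0.
have rE : rot (g / h)%g - 1%:M = (rot g - rot h) *m (rot h)^T.
  by rewrite rotM rotV orthogonal_inv// mulmxBl orthogonal_tr.
have r1 : `|rot (g / h)%g - 1%:M| <= n%:R * e.
  rewrite rE; apply: le_trans (mx_norm_mul _ _) _; rewrite -mulrA.
  apply: ler_wpM2l => //; rewrite mx_norm_tr -[leRHS]mulr1.
  by apply: ler_pM => //; exact: orthogonal_norm.
suff : (g / h)%g = 1%g.
  by move=> /(congr1 (fun k => k * h)%g); rewrite divgK mul1g.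
apply: disc; first exact: subgroupF.
  apply: le_lt_trans r1 _; rewrite ec ltr_pM2r// /c.
  by have := normr_ge0 r; nra.
have -> : (g / h)%g.2 = (g.2 - h.2) - (rot (g / h)%g - 1%:M) *m h.2.
  by rewrite trn_div mulmxBl mul1mx opprB addrA subrK.
apply: le_lt_trans (ler_normB _ _) _.
have n2 : `|(rot (g / h)%g - 1%:M) *m h.2| <= n%:R * n%:R * `|r| * e.
  apply: le_trans (mx_norm_mul _ _) _.
  have hr' : `|h.2| <= `|r|.
    by apply: le_trans (mx_norm_enorm _) _; apply: le_trans hr (ler_norm r).
  have -> : n%:R * n%:R * `|r| * e = (n%:R * (n%:R * e)) * `|r| by ring.
  by apply: ler_pM => //; rewrite ?mulr_ge0//; apply: ler_wpM2l.
have := lerD close2 n2; move=> /le_lt_trans; apply.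
rewrite [ltRHS]ec /c; have n0 : 0 <= (n%:R : R) by [].
by rewrite !mulrDl; have := mulr_ge0 n0 (ltW e0); lra.
Qed.

Lemma exists_min_translation (S : set (Aff R n)) :
  S `<=` G -> S !=set0 ->
  exists2 g, S g & forall h, S h -> enorm g.2 <= enorm h.2.
Proof.
move=> SG [g0 Sg0].
have fin : finite_set [set g | S g /\ enorm g.2 <= enorm g0.2].
  apply: sub_finite_set (finite_bounded (enorm g0.2)) => g [Sg gr].
  by split=> //; exact: SG.
have [|g [Sg g0r] gmin] := finite_min (fun g => enorm g.2) fin.
  by exists g0; split.
exists g => // h Sh; have [hr|/ltW] := leP (enorm h.2) (enorm g0.2).
  exact: gmin.
exact: le_trans.
Qed.

Lemma aff_fun_continuous (g : Aff R n) : continuous (aff_fun g).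
Proof.
move=> x; apply: continuous_mx => i j.
have -> : (fun y => aff_fun g y i j) =
    (fun y => \sum_k rot g i k * y k j + g.2 i j).
  by apply/funext => y; rewrite /aff_fun mxE [X in X + _ = _]mxE.
have c : continuous (fun y : 'cV[R]_n => \sum_k rot g i k * y k j : R^o).
  apply: continuous_sum => k y.
  exact: (cvgMr (@coord_continuous R n 1 k j y)).
have := @cvgD R R^o _ (nbhs x) _ _ _ _ _ (c x)
  (@cvg_cst _ (g.2 i j) _ (nbhs x) _).
exact.
Qed.

(** Cocompactness: the quotient is exhausted by the images of the balls. *)
Lemma cobounded : exists2 D : R, 0 <= D &
  forall x, exists2 g, G g & enorm (aff_fun g x) <= D.
Proof.
have [_ _ /compact_near_coveringP cov] := cryst.
pose p : 'cV[R]_n -> affine_quotient Gamma :=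
  \pi_{eq_quot affine_orbit_equiv Gamma}%qT.
have pP x y : p x = p y <-> exists2 g, G g & y = aff_fun g x.
  split=> [/eqmodP/asboolP//|xy].
  exact/(@eqmodP _ (affine_orbit_equiv Gamma))/asboolP.
pose D k : set (affine_quotient Gamma) :=
  [set t | exists2 x, `|x| < k%:R & p x = t].
have oD k : open (D k).
  rewrite /open /= /quotient_open.
  have -> : p @^-1` D k =
      \bigcup_(g in G) (aff_fun g @^-1` [set x | `|x| < k%:R]).
    apply/seteqP; split=> [y [x xk /esym/pP[g Gg xg]]|y [g Gg yk]].
      by exists g => //; rewrite /= -xg.
    by exists (aff_fun g y) => //; apply/esym/pP; exists g.
  apply: bigcup_open => g _; apply: open_comp => [y _|].
    exact: aff_fun_continuous.
  have -> : [set x : 'cV[R]_n | `|x| < k%:R] = ball (0 : 'cV[R]_n) k%:R.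
    by apply/seteqP; split=> x; rewrite -ball_normE /= sub0r normrN.
  exact: ball_open.
have /cov : forall t, [set: affine_quotient Gamma] t ->
    \forall t' \near t & k \near \oo, D k t'.
  move=> t _; have [x ->] : exists x, t = p x.
    exists (generic_quotient.repr (t : {eq_quot affine_orbit_equiv Gamma})).
    by rewrite /p reprK.
  have Dk0 : D (Num.truncn `|x|).+1 (p x) by exists x => //; exact: truncnS_gt.
  exists (D (Num.truncn `|x|).+1,
    [set k | ((Num.truncn `|x|).+1 <= k)%N]) => /=.
    split; first exact: open_nbhs_nbhs (conj (oD _) Dk0).
    by exists (Num.truncn `|x|).+1.
  move=> [t' k] /= [[y yk <-] kk]; exists y => //.
  by apply: (lt_le_trans yk); rewrite ler_nat.
move=> [k _ /(_ k (leqnn k))] Dk.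
exists (n%:R * k%:R) => [|x]; first exact: mulr_ge0.
have [y yk /esym/pP[g Gg xg]] := Dk (p x) I.
exists g => //; rewrite -xg; apply: le_trans (enorm_mx_norm _) _.
by apply: ler_wpM2l => //; exact: ltW.
Qed.

(** Among elements that move the origin close to the points [2 ^ l J u], two
    have nearly equal rotations, by the pigeonhole principle.  Their quotient has a
    small rotation, and it translates roughly along [u]: the rotation spoils the
    direction in proportion to the smaller multiple of [u], which is at most the
    difference of the two. *)
Lemma translation_direction u (eps delta : R) :
  enorm u = 1 -> 0 < eps -> 0 < delta ->
  exists b s, [/\ G b, 0 < s, small (rot b) eps &
    enorm (b.2 - s *: u) <= delta * s].
Proof.
move=> u1 eps0 delta0; have [D D0 cob] := cobounded.
pose J := (Num.truncn (4 * D / delta)).+1.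
have JD : 4 * D <= delta * J%:R.
  by rewrite -ler_pdivrMl// [_^-1 * _]mulrC /J ltW// truncnS_gt.
have J0 : 0 < (J%:R : R) by rewrite ltr0n.
pose e := Num.min eps (delta / 2).
have e0 : 0 < e by rewrite lt_min eps0 divr_gt0.
have near_ku (l : nat) :
    exists2 b, G b & enorm (b.2 - (2 ^ l * J)%:R *: u) <= D.
  have [g Gg gD] := cob ((2 ^ l * J)%:R *: u).
  exists g^-1%g; first exact: subgroupV.
  have Og := rot_orth Gg.
  rewrite -(enorm_orth _ Og) mulmxBr.
  rewrite trnV mulmxN mulmxA mulmxV ?rot_unit// mul1mx -opprD enormN addrC.
  exact: gD.
pose b l := s2val (cid2 (near_ku l)).
have Gb l : G (b l) by exact: s2valP (cid2 (near_ku l)).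
have bD l : enorm ((b l).2 - (2 ^ l * J)%:R *: u) <= D.
  exact: s2valP' (cid2 (near_ku l)).
pose eta := e / (n%:R ^+ 2 + 1).
have n21 : 0 < n%:R ^+ 2 + 1 :> R by rewrite ltr_pwDr// exprn_ge0.
have eta0 : 0 < eta by exact: divr_gt0.
have [l [l' [ll' close]]] : exists l l',
    (l < l')%N /\ `|rot (b l') - rot (b l)| <= eta.
  apply: contrapT => none; apply: infinite_nat.
  apply: (@separated_finite R nat n n setT (fun l => rot (b l)) 1 eta) => //.
    by move=> l _; exact/orthogonal_norm/rot_orth.
  move=> l l' _ _ ll.
  have [lt|lt|//] := ltngtP l l'; exfalso; apply: none.
    by exists l, l'; rewrite distrC.
  by exists l', l.
pose k := (2 ^ l * J)%N; pose k' := (2 ^ l' * J)%N.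
have kk : (k + k <= k')%N.
  rewrite /k /k' addnn -mul2n mulnA -expnS leq_mul2r; apply/orP; right.
  by rewrite leq_pexp2l.
have Jk : (J <= k)%N by rewrite /k leq_pmull// expn_gt0.
pose s : R := k'%:R - k%:R.
have ks : k%:R <= s by rewrite /s lerBrDr -natrD ler_nat.
have Js : J%:R <= s by apply: le_trans ks; rewrite ler_nat.
have Ol := rot_orth (Gb l); have Ol' := rot_orth (Gb l').
pose c := (b l' / b l)%g.
have Gc : G c by exact: subgroupF.
have sc : small (rot c) e.
  move=> x; rewrite /disp /c rotM rotV orthogonal_inv//.
  have -> : rot (b l') *m (rot (b l))^T *m x - x =
      (rot (b l') - rot (b l)) *m ((rot (b l))^T *m x).
    by rewrite mulmxBl !mulmxA orthogonal_tr// mul1mx.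
  apply: le_trans (enorm_mulmx _ _) _.
  rewrite enorm_orth; last exact: orthogonalT.
  apply: ler_wpM2r; first exact: enorm_ge0.
  apply: (@le_trans _ _ (n%:R ^+ 2 * eta)).
    by apply: ler_wpM2l => //; exact: exprn_ge0.
  rewrite /eta mulrA ler_pdivrMr// mulrC; apply: ler_wpM2l; first exact: ltW.
  by rewrite lerDl.
exists c, s; split=> //.
- exact: lt_le_trans J0 Js.
- by apply: small_le sc; rewrite ge_min lexx.
have -> : c.2 - s *: u = ((b l').2 - k'%:R *: u) -
    (rot c *m ((b l).2 - k%:R *: u) + disp (rot c) (k%:R *: u)).
  rewrite /c trn_div -/c /s /disp mulmxBr scalerBl addrA subrK !opprB.
  by rewrite addrACA [RHS]addrACA; congr (_ + _); rewrite addrC.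
apply: le_trans (enormB _ _) _.
have h1 := bD l'; rewrite -/k' in h1.
have h2 : enorm (rot c *m ((b l).2 - k%:R *: u)) <= D.
  by rewrite enorm_orth; [exact: bD|exact: rot_orth].
have h3 : enorm (disp (rot c) (k%:R *: u)) <= e * k%:R.
  by apply: le_trans (sc _) _; rewrite enormZ u1 mulr1 ger0_norm.
have h4 := enormD (rot c *m ((b l).2 - k%:R *: u)) (disp (rot c) (k%:R *: u)).
have h5 : e * k%:R <= delta / 2 * s.
  by apply: ler_pM => //; [exact: ltW|rewrite /e ge_min lexx orbT].
have h6 : delta * J%:R <= delta * s by apply: ler_wpM2l => //; exact: ltW.
lra.
Qed.

End Bieberbach.

Section SmallRotations.
Variables (R : realType) (n : nat) (Gamma : subgroup (Aff R n)).
Hypothesis cryst : crystallographic Gamma.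
Notation G := (subgroup_set Gamma).

Lemma disp_mulmx (A B : 'M[R]_n) x :
  A *m (B *m x) - B *m (A *m x) = disp A (disp B x) - disp B (disp A x).
Proof.
rewrite /disp !mulmxBr.
move: (A *m (B *m x)) (B *m (A *m x)) (A *m x) (B *m x) => P Q p q.
by apply/colP => i; rewrite !mxE; ring.
Qed.

(** With [x = B A y], the displacement of [x] by the commutator is the
    commutator of the displacements at [y]. *)
Lemma small_commutator (A B : 'M[R]_n) mu nu : 0 <= mu -> 0 <= nu ->
  Defs.orthogonal A -> Defs.orthogonal B -> small A mu -> small B nu ->
  small (A *m B *m invmx (B *m A)) (2 * mu * nu).
Proof.
move=> mu0 nu0 OA OB sA sB x; have OBA := orthogonalM OB OA.
have uBA : B *m A \in unitmx by have [] := mulmx1_unit OBA.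
set y := invmx (B *m A) *m x.
have -> : disp (A *m B *m invmx (B *m A)) x =
    disp A (disp B y) - disp B (disp A y).
  by rewrite -disp_mulmx !mulmxA /disp mulmxV// mul1mx.
have -> : enorm x = enorm y.
  by rewrite /y orthogonal_inv// enorm_orth//; exact: orthogonalT.
apply: le_trans (enormB _ _) _; have y0 := enorm_ge0 y.
have h1 : enorm (disp A (disp B y)) <= mu * (nu * enorm y).
  by apply: le_trans (sA _) _; apply: ler_wpM2l.
have h2 : enorm (disp B (disp A y)) <= nu * (mu * enorm y).
  by apply: le_trans (sB _) _; apply: ler_wpM2l.
lra.
Qed.

(** The scalar inequality that makes the cone condition of
    [small_rotation_trivial] pass to commutators: [rho], [mu] are the rate of
    displacement and the size of the rotation of an element, and [K] is large
    enough to absorb the error made when its rotation is nontrivial. *)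
Lemma cone_step (s K mu rho : R) : 0 < s -> 0 <= mu -> K * s = 2 ->
  s + K * mu <= rho -> rho <= 4^-1 ->
  (s + K * (mu / 2)) * (rho + 2 * mu) <= rho ^+ 2 - mu / 2.
Proof.
move=> s0 mu0 Ks r1 r2.
have K0 : 0 < K by rewrite -(pmulr_lgt0 _ s0) Ks.
have rs : s <= rho by have := mulr_ge0 (ltW K0) mu0; lra.
have h1 : (s + K * (mu / 2)) * (rho + 2 * mu) <=
    (rho - K * (mu / 2)) * (rho + 2 * mu) by apply: ler_wpM2r; lra.
apply: le_trans h1 _.
have h2 : 2 <= K * rho by rewrite -Ks ler_wpM2l// ltW.
have h3 : mu * 2 <= mu * (K * rho) by apply: ler_wpM2l.
have h4 : mu * rho <= mu * 4^-1 by apply: ler_wpM2l.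
have h5 : 0 <= K * mu * mu by rewrite !mulr_ge0// ltW.
nra.
Qed.

(** A rotation part close to the identity is trivial.  Otherwise let [a] be such
    an element with the shortest translation part, and consider elements [b]
    with much smaller rotation whose translation part is displaced by [rot a] at
    a rate bounded below.  Commutation with [a] halves the rotation of [b],
    keeps the rate bounded below and shortens the translation part, so that
    there is no such [b] with shortest translation part. *)
Lemma small_rotation_trivial a : G a -> small (rot a) 4^-1 -> rot a = 1%:M.
Proof.
move=> Ga0 sa0; apply: contrapT => a01.
pose S1 : set (Aff R n) :=
  [set g | [/\ G g, small (rot g) 4^-1 & rot g <> 1%:M]].
have [||{Ga0 sa0 a01} {}a [Ga sa a1] amin] :=
    exists_min_translation cryst (S := S1).
- by move=> g [].
- by exists a.
set A := rot a in sa a1 *.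
have OA : Defs.orthogonal A by exact: (rot_orth cryst Ga).
have [u [u1 t0]] : exists u, enorm u = 1 /\ 0 < enorm (disp A u).
  apply: contrapT => none; apply: a1; apply/matrixP => i j.
  suff E : disp A (delta_mx j 0) = 0.
    have : (A *m (delta_mx j 0 : 'cV_n)) i 0 = (delta_mx j 0 : 'cV_n) i 0.
      by rewrite -[A *m _](subrK (delta_mx j 0)) -/(disp A _) E add0r.
    by rewrite -colE !mxE andbT eq_sym => ->; rewrite eq_sym.
  apply: contrapT => /eqP/enorm_gt0 E; apply: none; exists (delta_mx j 0).
  by split=> //; rewrite /enorm /dot trmx_delta mul_delta_mx !mxE !eqxx sqrtr1.
set t := enorm (disp A u) in t0.
have t4 : t <= 4^-1 by have := sa u; rewrite u1 mulr1.
pose s := t / 2; pose K := 4 / t; pose eps := t ^+ 2 / 32.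
have s0 : 0 < s by exact: divr_gt0.
have K0 : 0 < K by exact: divr_gt0.
have Ks : K * s = 2 by rewrite /K /s; field; rewrite gt_eqF.
have eps0 : 0 < eps by rewrite divr_gt0// exprn_gt0.
have eps8 : eps <= 8^-1 by rewrite /eps; nra.
pose S2 : set (Aff R n) := [set b | G b /\ exists mu, [/\ 0 <= mu <= eps,
  small (rot b) mu, b.2 <> 0 & (s + K * mu) * enorm b.2 <= enorm (disp A b.2)]].
have [||b [Gb [mu [/andP[mu0 mue] sb b0 cone]]] bmin] :=
    exists_min_translation cryst (S := S2); first by move=> g [].
  have [b [sg [Gb sg0 sb bu]]] := translation_direction cryst u1 eps0 s0.
  exists b; split=> //; exists eps; rewrite (ltW eps0) lexx.
  set e := b.2 - sg *: u in bu.
  have bE : b.2 = sg *: u + e by rewrite /e addrC subrK.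
  have h1 : sg * t - 4^-1 * (s * sg) <= enorm (disp A b.2).
    rewrite bE dispD; apply: le_trans (enorm_addr _ _).
    rewrite dispZ enormZ gtr0_norm//.
    apply: lerB => //; apply: le_trans (sa e) _; exact: ler_wpM2l.
  have h2 : enorm b.2 <= sg + s * sg.
    rewrite bE; apply: le_trans (enormD _ _) _.
    rewrite enormZ u1 mulr1 gtr0_norm//.
    by rewrite lerD2l.
  (* [s + K eps = 5 t / 8] and [s <= 1 / 8] leave room for the error [e]. *)
  have h3 : (s + K * eps) * (sg + s * sg) <= sg * t - 4^-1 * (s * sg).
    have -> : s + K * eps = t * (5 / 8).
      by rewrite /s /K /eps; field; rewrite gt_eqF.
    rewrite /s; have := mulr_gt0 sg0 t0; nra.
  have h4 : 0 <= s + K * eps.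
    by apply: addr_ge0; [exact: ltW|apply: mulr_ge0; exact: ltW].
  split=> //.
    move=> b0; move: h1; rewrite b0 /disp mulmx0 subr0 enorm0.
    by rewrite /s; have := mulr_gt0 sg0 t0; lra.
  by apply: le_trans h1; apply: le_trans h3; exact: ler_wpM2l.
set B := rot b in sb; have OB : Defs.orthogonal B by exact: (rot_orth cryst Gb).
have nb : 0 < enorm b.2 by apply: enorm_gt0; exact/eqP.
pose c := ((a * b) / (b * a))%g.
have Gc : G c by apply: subgroupF; exact: subgroupM.
have rc : rot c = A *m B *m invmx (B *m A) by [].
have sc : small (rot c) (mu / 2).
  have h4 : 0 <= 4^-1 :> R by [].
  rewrite rc; have := small_commutator h4 mu0 OA OB sa sb.
  by apply: small_le; lra.
pose r := - disp (rot c) b.2 - A *m disp B (invmx A *m a.2).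
have cE : c.2 = disp A b.2 + r.
  rewrite /c trn_div -/c !trnM -/A -/B mulmxDr [rot c *m (B *m _)]mulmxA.
  have -> : rot c *m B = A *m B *m invmx A.
    rewrite rc (orthogonal_inv (orthogonalM OB OA)) (orthogonal_inv OA).
    by rewrite trmx_mul -!mulmxA OB mulmx1.
  rewrite /r; have -> : A *m disp B (invmx A *m a.2) =
      A *m B *m invmx A *m a.2 - a.2.
    by rewrite /disp mulmxBr !mulmxA mulmxV ?rot_unit// mul1mx.
  rewrite /disp -!mulmxA.
  move: (A *m b.2) (rot c *m b.2) (A *m (B *m (invmx A *m a.2))) => p q P.
  by apply/colP => i; rewrite !mxE; ring.
(* Unless [rot b] is trivial, the choice of [a] makes its translation part no
   longer than that of [b]. *)
have ab : enorm (A *m disp B (invmx A *m a.2)) <= mu * enorm b.2.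
  rewrite enorm_orth//.
  have [B1|B1] := pselect (B = 1%:M).
    by rewrite /disp B1 mul1mx subrr enorm0 mulr_ge0// ltW.
  apply: le_trans (sb _) _; apply: ler_wpM2l => //.
  rewrite orthogonal_inv// enorm_orth; last exact: orthogonalT.
  by apply: amin; split=> //; apply: small_le sb; lra.
have rr : enorm r <= 2 * mu * enorm b.2.
  apply: le_trans (enormB _ _) _; rewrite enormN.
  have := sc b.2; have := mulr_ge0 mu0 (ltW nb); lra.
pose rho := enorm (disp A b.2) / enorm b.2.
have rhoE : enorm (disp A b.2) = rho * enorm b.2 by rewrite /rho divfK// gt_eqF.
have rho1 : s + K * mu <= rho by rewrite /rho ler_pdivlMr.
have rho2 : rho <= 4^-1 by rewrite /rho ler_pdivrMr.
clearbody rho.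
have rho0 : 0 < rho.
  by apply: lt_le_trans rho1; rewrite ltr_pwDl// mulr_ge0// ltW.
have c_le : enorm c.2 <= (rho + 2 * mu) * enorm b.2.
  by rewrite cE; apply: le_trans (enormD _ _) _; rewrite rhoE; lra.
have c_lt : enorm c.2 < enorm b.2.
  by apply: (le_lt_trans c_le); rewrite -[ltRHS]mul1r ltr_pM2r//; lra.
have dc : (rho ^+ 2 - mu / 2) * enorm b.2 <= enorm (disp A c.2).
  rewrite cE dispD; apply: le_trans (enorm_addr _ _).
  have h1 := disp_convex b.2 OA; have h2 := sa r.
  have h3 : rho ^+ 2 * enorm b.2 <= enorm (disp A (disp A b.2)).
    rewrite -(ler_pM2l nb); apply: le_trans h1.
    by rewrite rhoE exprMn; have -> : enorm b.2 * (rho ^+ 2 * enorm b.2) =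
      rho ^+ 2 * enorm b.2 ^+ 2 by ring.
  by rewrite mulrBl; lra.
have step := cone_step s0 mu0 Ks rho1 rho2.
have cone' : (s + K * (mu / 2)) * enorm c.2 <= enorm (disp A c.2).
  apply: le_trans dc; have sK : 0 <= s + K * (mu / 2).
    apply: addr_ge0; first exact: ltW.
    by apply: mulr_ge0; [exact: ltW|exact: divr_ge0].
  apply: le_trans (ler_wpM2l sK c_le) _.
  by rewrite mulrA; apply: ler_wpM2r; [exact: ltW|exact: step].
suff /bmin : S2 c by rewrite leNgt c_lt.
split=> //; exists (mu / 2); split=> //.
  by apply/andP; split; lra.
move=> c0; have : 0 < enorm (disp A c.2).
  apply: lt_le_trans dc; apply: mulr_gt0 => //; apply: lt_le_trans step.
  have K2 : 0 <= K * (mu / 2).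
    by apply: mulr_ge0; [exact: ltW|exact: divr_ge0].
  by apply: mulr_gt0; [exact: ltr_pwDl|rewrite ltr_pwDl// mulr_ge0].
by rewrite c0 /disp mulmx0 subr0 enorm0 ltxx.
Qed.

Definition translations : set 'cV[R]_n := [set v | G ((1%g, v) : Aff R n)].
Notation L := translations.

Lemma translations0 : L 0. Proof. exact: subgroup1. Qed.

Lemma translationsB v w : L v -> L w -> L (v - w).
Proof.
move=> Lv Lw; have := subgroupF Lv Lw; congr (G _); apply: Aff_eq.
  by rewrite rotM rotV mulmxV ?rot_unit.
by rewrite trn_div rotM rotV mulmxV ?rot_unit// mul1mx.
Qed.

Lemma translationsD v w : L v -> L w -> L (v + w).
Proof.
move=> Lv Lw; rewrite -[w]opprK -[- w]sub0r; apply: translationsB => //.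
exact: translationsB translations0 Lw.
Qed.

Lemma finite_translations (r : R) : finite_set [set v | L v /\ enorm v <= r].
Proof.
have H := finite_bounded cryst r.
have : finite_set ((fun g : Aff R n => g.2) @` [set g | G g /\ enorm g.2 <= r]).
  exact: finite_image.
by apply: sub_finite_set => v [Lv vr]; exists ((1%g, v) : Aff R n).
Qed.

(** A unit vector orthogonal to all translations of the group would be close to
    the direction of one of them. *)
Lemma translation_basis : exists2 V : 'M[R]_n, V \in unitmx &
  forall j, L (col j V).
Proof.
have [d [B [fB LB BL]]] := maximal_free_rows [set v : 'rV[R]_n | L v^T].
have fBt : row_free B^T.
  rewrite -kermx_eq0; apply/eqP/row_matrixP => i; rewrite row0.
  set v := row i _; apply/eqP; apply: contraT => v0.
  have vB : v *m B^T = 0 by apply/sub_kermxP/row_sub.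
  have vL w : L w -> dot w v^T = 0.
    move=> Lw; have /submxP[D wD] : (w^T <= B)%MS.
      by apply: BL; rewrite /= trmxK.
    by rewrite /dot wD -mulmxA -[B]trmxK -trmx_mul vB trmx0 mulmx0 mxE.
  have v0' : v^T != 0.
    apply: contra v0 => /eqP/(congr1 trmx).
    by rewrite trmxK trmx0 => ->.
  have nv := enorm_gt0 v0'.
  pose u := (enorm v^T)^-1 *: v^T.
  have u1 : enorm u = 1.
    by rewrite /u enormZ ger0_norm ?invr_ge0 ?ltW// mulVf// gt_eqF.
  have q0 : 0 < 4^-1 :> R by [].
  have [b [s [Gb s0 sb bu]]] := translation_direction cryst u1 q0 q0.
  have b1 := small_rotation_trivial Gb sb.
  have Lb : L b.2 by rewrite /L /=; move: Gb; congr (G _); exact: Aff_eq.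
  have bu0 : dot b.2 u = 0 by rewrite /u dotZr vL// mulr0.
  have := dot_le (s *: u - b.2) u.
  rewrite u1 mulr1 dotDl dotNl bu0 subr0 dotZl -sqr_enorm u1 expr1n mulr1 => h.
  by move: bu; rewrite -enormN opprB; lra.
have dn : d = n.
  by rewrite -(eqP fB) -mxrank_tr (eqP fBt).
subst d; exists B^T; first by rewrite unitmx_tr -row_free_unit.
by move=> j; rewrite -tr_row; exact: LB.
Qed.

End SmallRotations.
(** * The normalizer acts on the translation lattice *)

Section NormalizerAction.
Variables (R : realType) (n : nat) (Gamma : subgroup (Aff R n)).
Hypothesis cryst : crystallographic Gamma.
Notation G := (subgroup_set Gamma).
Notation L := (translations Gamma).
Notation N := (subgroup_type (Nflat Gamma)).

Definition nmx (A : N) : 'M[R]_n := \val (\val A).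

Lemma nmx_unit A : nmx A \in unitmx. Proof. exact: Defs.GL_unit. Qed.

Lemma nmxM A B : nmx (A * B)%g = nmx A *m nmx B. Proof. by []. Qed.
Lemma nmx1 : nmx 1%g = 1%:M. Proof. by []. Qed.
Lemma nmxV A : nmx A^-1%g = invmx (nmx A). Proof. by []. Qed.

Lemma nmx_inj : injective nmx.
Proof. by move=> A B AB; do 2 apply: val_inj. Qed.

Lemma nmx_translations A v : L v -> L (nmx A *m v).
Proof.
have [g Ng gA] := set_mem (valP A).
have /normalizerP/(_ ((1%g, nmx A *m v) : Aff R n)) NG := Ng.
move=> Lv; rewrite /translations /= -NG; move: Lv; congr (G _).
have rA : rot g = nmx A by rewrite /nmx -gA.
apply: Aff_eq.
  by rewrite /conjg !rotM rotV mul1mx mulVmx ?rot_unit.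
rewrite /conjg !trnM trnV rotV -[rot (_, _)]/(1%:M).
rewrite -[(_, nmx A *m v).2]/(nmx A *m v).
rewrite mul1mx mulmxDr mulmxA -rA mulVmx ?rot_unit// mul1mx.
by rewrite addrAC subrr add0r.
Qed.

Lemma translations_discrete : exists2 eps : R, 0 < eps &
  forall v, L v -> `|v| <= eps -> v = 0.
Proof.
have [eps eps0 disc] := discrete_at_one cryst.
exists (eps / 2) => [|v Lv ve]; first exact: divr_gt0.
have H : (1%g, v) = 1%g :> Aff R n.
  apply: disc => //; first by rewrite -[rot _]/(1%:M) subrr normr0.
  by apply: (le_lt_trans ve); rewrite ltr_pdivrMr// ltr_pMr// ltr1n.
exact: (congr1 snd H).
Qed.

Lemma mulmx_col (A B : 'M[R]_n) j : A *m col j B = col j (A *m B).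
Proof. by rewrite !colE mulmxA. Qed.

Lemma eq_on_basis (V A B : 'M[R]_n) : V \in unitmx ->
  (forall j, A *m col j V = B *m col j V) -> A = B.
Proof.
move=> uV AB; rewrite -(mulmxK uV A) -(mulmxK uV B); congr (_ *m _).
by apply/matrixP => i j; have /colP/(_ i) := AB j; rewrite !mulmx_col !mxE.
Qed.

(** A matrix that preserves the lattice is determined by the images of a basis,
    which are lattice vectors; the lattice being discrete, bounded matrices of
    this kind are finite in number. *)
Lemma finite_normalizer (r : R) : finite_set [set A : N | `|nmx A| <= r].
Proof.
have [V uV LV] := translation_basis cryst.
have [eps eps0 disc] := translations_discrete.
apply: (@separated_finite R N n n _ (fun A => nmx A *m V)
  (n%:R * r * `|V|) eps) => //.
  move=> A Ar; apply: le_trans (mx_norm_mul _ _) _.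
  by apply: ler_wpM2r => //; apply: ler_wpM2l.
move=> A B _ _ AB; apply: nmx_inj; apply: (eq_on_basis uV) => j.
apply/eqP; rewrite -subr_eq0; apply/eqP; apply: disc.
  by apply: translationsB; apply: nmx_translations; exact: LV.
apply: le_trans AB; apply: mx_norm_le => // i k.
rewrite ord1 !mulmx_col; have := mx_entry_le (nmx A *m V - nmx B *m V) i j.
by move: (nmx A *m V) (nmx B *m V) => P P'; rewrite !mxE.
Qed.

(** * The normalizer acts properly *)

Lemma qform_le (S : 'M[R]_n) v : qform S v <= n%:R ^+ 2 * `|S| * `|v| ^+ 2.
Proof.
apply: le_trans (ler_norm _) _; apply: le_trans (mx_entry_le _ _ _) _.
apply: le_trans (mx_norm_mul _ _) _; rewrite mx_norm_tr.
have -> : n%:R ^+ 2 * `|S| * `|v| ^+ 2 =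
    n%:R * (n%:R * `|v| * `|S|) * `|v| by ring.
by apply: ler_wpM2r => //; apply: ler_wpM2l => //; exact: mx_norm_mul.
Qed.

Definition gram (t : Tflat Gamma) : 'M[R]_n :=
  (\val (Tflat_repr t))^T *m \val (Tflat_repr t).

Lemma gram_pi X : gram (quot_pi (Tflat_equiv Gamma) X) = (\val X)^T *m \val X.
Proof. by apply/tpi_gram; exact: Tflat_reprK. Qed.

Lemma gram_continuous : continuous gram.
Proof.
apply: Tflat_continuous.
have -> : gram \o quot_pi (Tflat_equiv Gamma) =
    (fun X : 'M[R]_n => X^T *m X) \o (fun X : Cflat_space Gamma => \val X).
  by apply/funext => X /=; rewrite gram_pi.
move=> X; apply: (@continuous_comp _ _ _
  (fun X : Cflat_space Gamma => \val X : 'M[R]_n)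
  (fun X : 'M[R]_n => X^T *m X)); first exact: val_continuous.
apply: continuous_mx => i j.
have -> : (fun Z : 'M[R]_n => (Z^T *m Z) i j) = (fun Z => \sum_k Z k i * Z k j).
  by apply/funext => Z; rewrite mxE; apply: eq_bigr => k _; rewrite mxE.
apply: (@continuous_sum _ _ R^o) => k Z.
exact: (cvgM (@coord_continuous R n n k i Z) (@coord_continuous R n n k j Z)).
Qed.

Lemma gram_posdef t : posdef (gram t).
Proof. exact/posdef_gram/Cflat_unit. Qed.

Lemma gram_act t A : gram (Tflat_act t A) = (nmx A)^T *m gram t *m nmx A.
Proof.
have [X ->] := quot_pi_Tflat_surj t.
by rewrite Tflat_act_pi !gram_pi /= trmx_mul !mulmxA.
Qed.

(** A compact set of metrics is bounded above and below, so that the elements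
    that move it to meet itself are bounded. *)
Lemma Tflat_proper : proper_action (Tflat_raction Gamma).
Proof.
move=> K cK.
have cS : compact (gram @` K).
  apply: continuous_compact => //.
  exact/continuous_subspaceT/gram_continuous.
have pS S : (gram @` K) S -> posdef S by move=> [t _ <-]; exact: gram_posdef.
have [c c0 lower] := compact_posdef_lower cS pS.
have [M [_ /(_ (M + 1))]] := compact_bounded cS.
rewrite ltrDl => /(_ ltr01) upper.
pose q := n%:R ^+ 2 * `|M + 1| / c.
have q0 : 0 <= q by rewrite /q divr_ge0 ?mulr_ge0 ?exprn_ge0// ltW.
apply: sub_finite_set (finite_normalizer (1 + q)) => A [_ [[t Kt <-] KtA]].
have Sk : (gram @` K) (gram (Tflat_act t A)) by exists (Tflat_act t A).
apply: mx_norm_le => [|i j]; first exact: addr_ge0.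
pose v : 'rV[R]_n := delta_mx 0 j.
have v1 : `|v| <= 1.
  apply: mx_norm_le => // a b; rewrite mxE.
  by case: (_ && _); rewrite ?normr1 ?normr0.
have := lower _ (v *m (nmx A)^T) (ex_intro2 _ _ t Kt erefl).
have -> : qform (gram t) (v *m (nmx A)^T) = qform (gram (Tflat_act t A)) v.
  by rewrite gram_act /qform trmx_mul trmxK !mulmxA.
move=> low; have up := qform_le (gram (Tflat_act t A)) v.
have SM : `|gram (Tflat_act t A)| <= `|M + 1|.
  by apply: le_trans (upper _ Sk) _; exact: ler_norm.
have Aij : `|nmx A i j| <= `|v *m (nmx A)^T|.
  have -> : nmx A i j = (v *m (nmx A)^T) 0 i by rewrite -rowE !mxE.
  exact: mx_entry_le.
have up' : qform (gram (Tflat_act t A)) v <= n%:R ^+ 2 * `|M + 1|.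
  have n2 : 0 <= n%:R ^+ 2 :> R by exact: exprn_ge0.
  apply: le_trans up _; rewrite -[leRHS]mulr1; apply: ler_pM.
  - exact: mulr_ge0.
  - exact: exprn_ge0.
  - exact: ler_wpM2l.
  - exact: exprn_ile1.
have : `|v *m (nmx A)^T| ^+ 2 <= q.
  by rewrite /q ler_pdivlMr// mulrC; exact: le_trans low up'.
have := normr_ge0 (v *m (nmx A)^T); nra.
Qed.

(** * The congruence subgroup of level three *)

Definition congruent (v w : 'cV[R]_n) : Prop := exists2 u, L u & v - w = 3 *: u.

Lemma congruent_refl v : congruent v v.
Proof. by exists 0; [exact: translations0|rewrite subrr scaler0]. Qed.

Lemma congruent_sym v w : congruent v w -> congruent w v.
Proof.
move=> [u Lu vw]; exists (- u); last by rewrite scalerN -vw opprB.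
by rewrite -sub0r; exact: translationsB (translations0 _) Lu.
Qed.

Lemma congruent_trans v w x : congruent v w -> congruent w x -> congruent v x.
Proof.
move=> [a La vw] [b Lb wx]; exists (a + b); first exact: translationsD.
by rewrite scalerDr -vw -wx addrA subrK.
Qed.

Lemma congruent_nmx A v w :
  congruent v w -> congruent (nmx A *m v) (nmx A *m w).
Proof.
move=> [u Lu vw]; exists (nmx A *m u); first exact: nmx_translations.
by rewrite -mulmxBr vw scalemxAr.
Qed.

Definition level3 (A : N) : Prop := forall v, L v -> congruent (nmx A *m v) v.

(** Such an [A] is an isometry of the lattice for the metric [t], and
    [(A - 1) / 3] maps the lattice to itself.  Let [w] be a shortest lattice
    vector that [A] moves.  Its image [u] under [(A - 1) / 3] is shorter, hence
    fixed by [A], so that [(A - 1) ^ 2 w = 0]; for an isometry this implies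
    [(A - 1) w = 0], by [disp_convex]. *)
Lemma level3_free A t : level3 A -> Tflat_act t A = t -> A = 1%g.
Proof.
move=> A3; have [X ->] := quot_pi_Tflat_surj t; rewrite Tflat_act_pi.
move=> /esym/quot_pi_Tflat[Q OQ /= XA]; rewrite -/(nmx A) in XA.
set Y := \val X in XA; have uY : Y \in unitmx by exact: Cflat_unit.
have XAv v : Y *m (nmx A *m v) = Q *m (Y *m v) by rewrite !mulmxA XA.
have dQ v : Y *m disp (nmx A) v = disp Q (Y *m v).
  by rewrite /disp mulmxBr XAv.
have N0 v : enorm (Y *m v) = 0 -> v = 0.
  by move=> /enorm_eq0/(congr1 (mulmx (invmx Y))); rewrite mulKmx// mulmx0.
have fixL v : L v -> disp (nmx A) v = 0.
  move=> Lv; apply: contrapT => dv.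
  pose S : set 'cV[R]_n := [set w | L w /\ disp (nmx A) w <> 0].
  have fin : finite_set [set w | S w /\ enorm (Y *m w) <= enorm (Y *m v)].
    pose c := n%:R ^+ 2 * `|invmx Y| * enorm (Y *m v).
    apply: sub_finite_set (finite_translations cryst c) => w [[Lw _] wv].
    split=> //; rewrite -{1}[w](mulKmx uY).
    apply: le_trans (enorm_mulmx _ _) _; apply: ler_wpM2l wv.
    by apply: mulr_ge0 => //; exact: exprn_ge0.
  have [|w [[Lw dw] wv] wmin] := finite_min (fun w => enorm (Y *m w)) fin.
    by exists v.
  have [u Lu uw] := A3 w Lw.
  have du : disp (nmx A) w = 3 *: u by [].
  have Nw : 0 < enorm (Y *m w).
    rewrite lt_neqAle enorm_ge0 andbT; apply/eqP => /esym/N0 w0; apply: dw.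
    by rewrite w0 /disp mulmx0 subr0.
  have Nu : enorm (Y *m u) < enorm (Y *m w).
    have := enormB (Q *m (Y *m w)) (Y *m w).
    rewrite -/(disp Q _) -dQ du -scalemxAr enormZ enorm_orth// ger0_norm//.
    by move: Nw; lra.
  have du0 : disp (nmx A) u = 0.
    apply: contrapT => du0.
    have : enorm (Y *m w) <= enorm (Y *m u).
      by apply: wmin; split=> //; exact: le_trans (ltW Nu) wv.
    by rewrite leNgt Nu.
  apply: dw; apply: N0; apply/eqP; rewrite dQ -sqrf_eq0 eq_le sqr_ge0 andbT.
  apply: le_trans (disp_convex _ OQ) _.
  by rewrite -!dQ du dispZ du0 scaler0 mulmx0 enorm0 mulr0.
have [V uV LV] := translation_basis cryst.
apply: nmx_inj; rewrite nmx1; apply: (eq_on_basis uV) => j.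
by rewrite mul1mx; apply/eqP; rewrite -subr_eq0; apply/eqP; exact: fixL.
Qed.

Lemma translations_int V (z : 'I_n -> int) : (forall j, L (col j V)) ->
  L (V *m \col_j (z j)%:~R).
Proof.
move=> LV; have -> : V *m \col_j (z j)%:~R = \sum_j col j V *~ z j.
  apply/colP => i; rewrite mxE summxE; apply: eq_bigr => j _.
  by rewrite -[col j V *~ z j]scaler_int !mxE mulrC.
have LM v k : L v -> L (v *+ k).
  move=> Lv; elim: k => [|k IH]; first by rewrite mulr0n; exact: translations0.
  by rewrite mulrS; exact: translationsD.
have Lz v k : L v -> L (v *~ k).
  move=> Lv; case: k => k; first by exact: LM.
  rewrite NegzE mulrNz -sub0r; apply: translationsB; first exact: translations0.
  exact: LM.
elim/big_rec: _ => [|j v _ Lv]; first exact: translations0.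
by apply: translationsD => //; exact/Lz/LV.
Qed.

(** All classes modulo 3 are represented by the lattice vectors whose
    coordinates in a basis lie between 0 and 3. *)
Lemma finite_classes : exists s : seq 'cV[R]_n,
  (forall v, v \in s -> L v) /\
  forall v, L v -> exists2 w, w \in s & congruent v w.
Proof.
have [V uV LV] := translation_basis cryst.
have /finite_seqP[s sE] := finite_translations cryst (n%:R * (n%:R * `|V| * 3)).
have sP v : v \in s <-> L v /\ enorm v <= n%:R * (n%:R * `|V| * 3).
  by have /seteqP[s1 s2] := sE; split; [exact: s2|exact: s1].
exists s; split=> [v /sP[]//|v Lv].
pose y := invmx V *m v.
pose z j := Num.floor (y j 0 / 3).
pose x : 'cV[R]_n := \col_j (z j)%:~R.
have Lx : L (V *m x) by exact: translations_int.
exists (v - 3 *: (V *m x)); last first.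
  by exists (V *m x) => //; rewrite opprB addrC subrK.
have L3x : L (3 *: (V *m x)).
  have -> : 3 *: (V *m x) = V *m x + V *m x + V *m x.
    by apply/colP => i; rewrite !mxE; ring.
  by apply: translationsD => //; exact: translationsD.
apply/sP; split; first exact: translationsB.
apply: le_trans (enorm_mx_norm _) _; apply: ler_wpM2l => //.
have -> : v - 3 *: (V *m x) = V *m (y - 3 *: x).
  by rewrite mulmxBr -scalemxAr /y mulKVmx.
apply: le_trans (mx_norm_mul _ _) _.
apply: ler_wpM2l; first by rewrite mulr_ge0.
clearbody y; apply: mx_norm_le => // i j; rewrite ord1 !mxE /z.
have := ge_floor (y i 0 / 3); have := lt_succ_floor (y i 0 / 3).
rewrite ltr_pdivrMr// ler_pdivlMr// intrD mulr1z.
move: (Num.floor _) => f h1 h2; rewrite ger0_norm; lra.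
Qed.

Lemma level3_F A B : level3 A -> level3 B -> level3 (A / B)%g.
Proof.
move=> A3 B3 v Lv; rewrite nmxM nmxV.
have Lw : L (nmx B^-1%g *m v) by exact: nmx_translations.
have := A3 _ Lw; rewrite nmxV mulmxA => h1; apply: congruent_trans h1 _.
have := B3 _ Lw; rewrite nmxV mulmxA mulmxV ?nmx_unit// mul1mx.
exact: congruent_sym.
Qed.

Lemma level3_J A B : level3 A -> level3 (A ^ B)%g.
Proof.
move=> A3 v Lv; have Lw : L (nmx B *m v) by exact: nmx_translations.
have := congruent_nmx B^-1%g (A3 _ Lw).
by rewrite /conjg !nmxM nmxV !mulmxA mulVmx ?nmx_unit// mul1mx.
Qed.

(** The action on the lattice modulo 3 is recorded by the indices of the classes
    of the images of representatives. *)
Lemma level3_finite_index : exists (T : finType) (c : N -> T),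
  forall A B, c A = c B -> level3 (A^-1 * B)%g.
Proof.
have [s [sL sC]] := finite_classes.
pose ix v := find (fun w => `[< congruent v w >]) s.
have ixP v : L v -> (ix v < size s)%N /\ congruent v (nth 0 s (ix v)).
  move=> Lv; have hs : has (fun w => `[< congruent v w >]) s.
    by apply/hasP; have [w ws vw] := sC v Lv; exists w => //; exact/asboolP.
  by split; [rewrite -has_find|have := nth_find 0 hs => /asboolP].
pose c (A : N) : {ffun 'I_(size s) -> 'I_(size s).+1} :=
  [ffun i : 'I_(size s) => inord (ix (nmx A *m nth 0 s i))].
exists {ffun 'I_(size s) -> 'I_(size s).+1}, c => A B cAB v Lv.
have [lts vs] := ixP v Lv; set w := nth 0 s (ix v) in vs.
have Lw : L w by apply: sL; exact: mem_nth.
have [ltA Aw] := ixP _ (nmx_translations A Lw).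
have [ltB Bw] := ixP _ (nmx_translations B Lw).
have ixE : ix (nmx A *m w) = ix (nmx B *m w).
  have /ffunP/(_ (Ordinal lts)) := cAB; rewrite !ffunE /= -/w.
  by move/(congr1 val); rewrite /= !inordK// ltnS ltnW.
have BA : congruent (nmx B *m v) (nmx A *m v).
  apply: congruent_trans (congruent_nmx B vs) _.
  apply: congruent_trans Bw _; rewrite -ixE; apply: congruent_sym.
  exact: congruent_trans (congruent_nmx A vs) Aw.
have := congruent_nmx A^-1%g BA.
by rewrite nmxM nmxV !mulmxA mulVmx ?nmx_unit// mul1mx.
Qed.

End NormalizerAction.

(** * Finite quotient groups *)

Section FiniteQuotient.
Variables (N : groupType) (T : finType) (c : N -> T) (K : N -> Prop).
Hypothesis K1 : K 1%g.
Hypothesis KF : forall x y, K x -> K y -> K (x / y)%g.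
Hypothesis KJ : forall x y, K x -> K (x ^ y)%g.
Hypothesis cK : forall x y, c x = c y -> K (x^-1 * y)%g.

Let KM x y : K x -> K y -> K (x * y)%g.
Proof.
move=> Kx Ky; rewrite -[y]invgK; apply: KF => //.
by rewrite -[(y^-1)%g]mul1g; exact: KF.
Qed.

Let KV x : K x -> K x^-1%g.
Proof. by move=> Kx; rewrite -[(x^-1)%g]mul1g; exact: KF. Qed.

(** A coset is encoded by the finite set of values of [c] on it. *)
Let cl (x : N) : {set T} :=
  [set t | `[< exists2 y, K (x^-1 * y)%g & c y = t >]].

Let clP x y : cl x = cl y <-> K (x^-1 * y)%g.
Proof.
split=> [xy|Kxy].
  have : c y \in cl y by rewrite inE; apply/asboolP; exists y; rewrite ?mulVg.
  rewrite -xy inE => /asboolP[z Kxz /cK Kzy].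
  by have := KM Kxz Kzy; rewrite -mulgA mulKVg.
apply/setP => t; rewrite !inE; apply/asboolP/asboolP => -[z Kz <-];
  exists z => //.
  by have := KM (KV Kxy) Kz; rewrite invgM invgK -mulgA mulKVg.
by have := KM Kxy Kz; rewrite -mulgA mulKVg.
Qed.

Let Q := {S : {set T} | `[< exists x, cl x = S >]}.

Let clQ (x : N) : Q := exist _ (cl x) (asboolT (ex_intro _ x erefl)).

Let clQ_surj (q : Q) : exists x, clQ x = q.
Proof.
by case: q => S HS; have /asboolP[x xS] := HS; exists x; apply: val_inj.
Qed.

Let rep (q : Q) : N := sval (cid (clQ_surj q)).

Let repK q : clQ (rep q) = q.
Proof. by rewrite /rep; case: cid. Qed.

Let clQP x y : clQ x = clQ y <-> K (x^-1 * y)%g.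
Proof.
by rewrite -clP; split=> [/(congr1 val)//|xy]; apply: val_inj.
Qed.

Let mulQ q r := clQ (rep q * rep r)%g.
Let invQ q := clQ (rep q)^-1%g.

Let mulQE x y : mulQ (clQ x) (clQ y) = clQ (x * y)%g.
Proof.
apply/clQP.
have /clQP Kx := repK (clQ x); have /clQP Ky := repK (clQ y).
have := KM (KJ (rep (clQ y)) Kx) Ky.
by rewrite /conjg invgM !mulgA mulgK.
Qed.

Let invQE x : invQ (clQ x) = clQ x^-1%g.
Proof.
apply/clQP; have /clQP Kx := repK (clQ x).
have := KV (KJ (rep (clQ x))^-1%g Kx).
by rewrite /conjg !invgM !invgK !mulgA mulgK.
Qed.

Let mulQA : associative mulQ.
Proof.
move=> q r t; have [x <-] := clQ_surj q; have [y <-] := clQ_surj r.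
by have [z <-] := clQ_surj t; rewrite !mulQE mulgA.
Qed.

Let mulQ1 : left_id (clQ 1%g) mulQ.
Proof. by move=> q; have [x <-] := clQ_surj q; rewrite mulQE mul1g. Qed.

Let mul1Q : right_id (clQ 1%g) mulQ.
Proof. by move=> q; have [x <-] := clQ_surj q; rewrite mulQE mulg1. Qed.

Let mulVQ : left_inverse (clQ 1%g) invQ mulQ.
Proof. by move=> q; have [x <-] := clQ_surj q; rewrite invQE mulQE mulVg. Qed.

Let mulQV : right_inverse (clQ 1%g) invQ mulQ.
Proof. by move=> q; have [x <-] := clQ_surj q; rewrite invQE mulQE mulgV. Qed.

(** The quotient group is built on the finite type [Q] of encoded cosets. *)
Lemma finite_quotient : exists (H : finGroupType) (phi : N -> H),
  [/\ {morph phi : x y / (x * y)%g}, forall h, exists x, phi x = h &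
      forall x, phi x = 1%g -> K x].
Proof.
pose H : finGroupType :=
  HB.pack {S : {set T} | `[< exists x, cl x = S >]}
    (isGroup.Build Q mulQA mulQ1 mul1Q mulVQ mulQV).
exists H, clQ; split=> [x y|h|x].
- by rewrite -mulQE.
- exact: clQ_surj.
move=> /esym/(@clQP 1%g x).1; by rewrite invg1 mul1g.
Qed.

End FiniteQuotient.
Theorem proposition4p1 (R : realType) (n : nat) (Gamma : subgroup (Aff R n))
    (crystGamma : crystallographic Gamma) :
  very_good_orbifold (Mflat Gamma).
Proof.
have [GammaIso _ _] := crystGamma.
have [T [c cK]] := level3_finite_index crystGamma.
have l1 : level3 (1%g : subgroup_type (Nflat Gamma)).
  by move=> v _; rewrite nmx1 mul1mx; exact: congruent_refl.
have [H [phi [phiM phi_surj phi_ker]]] :=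
  finite_quotient l1 (@level3_F _ _ Gamma) (@level3_J _ _ Gamma) cK.
apply: (@very_good_quotient _ _ _ (Tflat_raction Gamma) H phi).
- exact: Tflat_manifold.
- exact: Tflat_smooth_action.
- exact: Tflat_proper.
- exact: phiM.
- exact: phi_surj.
by move=> A t /phi_ker; exact: level3_free.
Qed.
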